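(* Let $\mathcal{B}=\mathcal{B}(\ell^2(\mathbb{N}))$ and $\Gamma^\infty=\mathrm{span}\{\mathrm{diag}(\alpha)U_f:\alpha\in\ell^\infty,\ f\in\mathrm{Emb}\}\subset\mathcal{B}$. (i) The map $S\mapsto I_S$ is a bijection between the set of symmetric ideals of $\ell^\infty$ and the set of two-sided ideals of $\Gamma^\infty$. Its inverse maps an ideal $I\triangleleft\Gamma^\infty$ to the symmetric ideal $S(I)=\{\alpha\in\ell^\infty:\mathrm{diag}(\alpha)\in I\}$. (ii) The map $J\mapsto J\cap\Gamma^\infty$ is a bijection between the set of two-sided ideals of $\mathcal{B}$ and the set of two-sided ideals of $\Gamma^\infty$. Its inverse maps an ideal $I\triangleleft\Gamma^\infty$ to the two-sided ideal of $\mathcal{B}$ it generates. (iii) If $S\triangleleft\ell^\infty$ is a symmetric ideal, then $J_S\cap\Gamma^\infty=I_S$.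
   Context: All sequences are complex-valued and indexed by $\mathbb{N}=\{1,2,\dots\}$; $\ell^\infty$ is the algebra of bounded sequences. $\mathrm{Emb}$ is the inverse monoid of all partially defined injections $f:\mathrm{dom}(f)\to\mathbb{N}$, $\mathrm{dom}(f)\subset\mathbb{N}$, under composition of partial maps; $f^\dagger:\mathrm{ran}(f)\to\mathbb{N}$ denotes the inverse of $f$. $\mathrm{Emb}$ acts on $\ell^\infty$ by $f_*(\alpha)_n=\alpha_{f^\dagger(n)}$ if $n\in\mathrm{ran}(f)$ and $f_*(\alpha)_n=0$ otherwise. An ideal $S\triangleleft\ell^\infty$ is symmetric if $f_*(S)\subset S$ for all $f\in\mathrm{Emb}$. With $(e_n)$ the canonical basis of $\ell^2(\mathbb{N})$, $U_f(e_n)=e_{f(n)}$ if $n\in\mathrm{dom}(f)$ and $U_f(e_n)=0$ otherwise; $\mathrm{diag}(\alpha)(e_n)=\alpha_ne_n$. For a symmetric ideal $S$: $I_S=\mathrm{span}\{\mathrm{diag}(\alpha)U_f:\alpha\in S,\ f\in\mathrm{Emb}\}$, and $J_S\triangleleft\mathcal{B}$ is the two-sided ideal generated by $\{\mathrm{diag}(\alpha):\alpha\in S\}$. Ideals may be zero or the whole algebra. *)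

(* Defs.v *)
From HB Require Import structures.
From mathcomp Require Import all_boot all_order all_algebra.
From mathcomp Require Import complex ring lra.
From mathcomp Require Import boolp classical_sets functions reals topology.
From mathcomp Require Import normedtype sequences.
Import Order.TTheory GRing.Theory Num.Theory.
Import numFieldNormedType.Exports.
Import Normc.

Set Implicit Arguments.
Unset Strict Implicit.
Unset Printing Implicit Defensive.

Local Open Scope classical_set_scope.
Local Open Scope ring_scope.

(* Sequences are indexed by nat = {0, 1, ...} instead of {1, 2, ...}.  The    *)
(* complex numbers are R[i] for R : realType, with modulus normc : R[i] -> R. *)

(* Two-sided ideals.  Every D used below is a unital complex algebra, so that *)
(* closure under scalars follows from absorption.                            *)
Definition is_ideal (A : pzRingType) (D I : set A) : Prop :=
  [/\ I `<=` D, I 0, (forall x y, I x -> I y -> I (x - y)) &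
      (forall a x, D a -> I x -> I (a * x) /\ I (x * a))].

Definition ideals (A : pzRingType) (D : set A) : set (set A) :=
  [set I | is_ideal D I].

Definition ideal_gen (A : pzRingType) (X : set A) : set A :=
  smallest (is_ideal [set: A]) X.

Definition lin_span (K : pzRingType) (V : lmodType K) (X : set V) : set V :=
  [set v | exists (n : nat) (c : 'I_n -> K) (x : 'I_n -> V),
     (forall i, X (x i)) /\ v = \sum_(i < n) c i *: x i].

Definition bij_with_inverse (X Y : Type) (A : set X) (B : set Y)
    (f : X -> Y) (g : Y -> X) : Prop :=
  [/\ set_bij A B f, set_fun B A g,
      (forall x, A x -> g (f x) = x) & (forall y, B y -> f (g y) = y)].

(* Partially defined injections; f n = None means that n is not in dom f.    *)
Record Emb := MkEmb {
  emb_fun :> nat -> option nat;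
  emb_inj : forall m n k, emb_fun m = Some k -> emb_fun n = Some k -> m = n }.

Definition emb_inv_fun (f : Emb) (n : nat) : option nat :=
  if pselect (exists m, f m = Some n) is left ex then Some (projT1 (cid ex))
  else None.

Lemma emb_inv_funE (f : Emb) (m n : nat) :
  emb_inv_fun f n = Some m <-> f m = Some n.
Proof.
rewrite /emb_inv_fun; case: pselect => [ex|nex]; last first.
  by split=> // fm; case: nex; exists m.
case: cid => k /= fk; split=> [[<-]//|fm]; congr Some.
exact: emb_inj fk fm.
Qed.

Lemma emb_inv_inj (f : Emb) m n k :
  emb_inv_fun f m = Some k -> emb_inv_fun f n = Some k -> m = n.
Proof. by move=> /emb_inv_funE fm /emb_inv_funE; rewrite fm => -[]. Qed.

Definition emb_inv (f : Emb) : Emb := MkEmb (@emb_inv_inj f).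

Section sequences.
Variable R : realType.
Local Notation C := R[i].

Definition push (f : Emb) (x : nat -> C) : nat -> C :=
  fun n => if emb_inv f n is Some m then x m else 0.

Lemma normc_ge0 (z : C) : 0 <= normc z.
Proof. by case: z => a b; exact: sqrtr_ge0. Qed.

Definition bounded_seq : {pred nat -> C} :=
  mem [set x : nat -> C | exists M : R, forall n, normc (x n) <= M].

Lemma bounded_seqP x :
  reflect (exists M : R, forall n, normc (x n) <= M) (x \in bounded_seq).
Proof. by apply: (iffP idP) => [/set_mem|?]; last exact: mem_set. Qed.

Lemma bounded_seq_subring : subring_closed bounded_seq.
Proof.
split=> [|x y|x y].
- by apply/bounded_seqP; exists 1 => n; rewrite normc1.
- move=> /bounded_seqP[M xM] /bounded_seqP[N yN]; apply/bounded_seqP.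
  exists (M + N) => n; apply: (le_trans (le_normcD _ _)).
  by rewrite normcN lerD.
- move=> /bounded_seqP[M xM] /bounded_seqP[N yN]; apply/bounded_seqP.
  exists (M * N) => n; rewrite normcM ler_pM ?normc_ge0//.
Qed.
HB.instance Definition _ :=
  GRing.isSubringClosed.Build _ bounded_seq bounded_seq_subring.

Record linf := Linf { linf_val :> nat -> C; linf_valP : linf_val \in bounded_seq }.
HB.instance Definition _ := [isSub for linf_val].
HB.instance Definition _ := [Choice of linf by <:].
HB.instance Definition _ := [SubChoice_isSubComNzRing of linf by <:].

Lemma push_bounded (f : Emb) (a : linf) : push f a \in bounded_seq.
Proof.
have /bounded_seqP[M aM] := linf_valP a; apply/bounded_seqP; exists M => n.
rewrite /push; case: (emb_inv f n) => //.
by rewrite normc0; apply: le_trans (aM 0%N); exact: normc_ge0.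
Qed.

Definition linf_push (f : Emb) (a : linf) : linf := Linf (push_bounded f a).

Definition sqnormc (x : nat -> C) : nat -> R := fun n => normc (x n) ^+ 2.

Definition sq_summable : {pred nat -> C} :=
  mem [set x : nat -> C | cvgn (series (sqnormc x))].

Lemma sq_summableP x : reflect (cvgn (series (sqnormc x))) (x \in sq_summable).
Proof. by apply: (iffP idP) => [/set_mem|?]; last exact: mem_set. Qed.

Lemma sqnormc_ge0 x n : 0 <= sqnormc x n.
Proof. exact: sqr_ge0. Qed.

Lemma series_sqnormc_nd x : nondecreasing_seq (series (sqnormc x)).
Proof. by apply: nondecreasing_series => n _ _; exact: sqnormc_ge0. Qed.

Lemma series_sqnormc_le x N :
  cvgn (series (sqnormc x)) -> series (sqnormc x) N <= limn (series (sqnormc x)).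
Proof. by move=> cx; exact: nondecreasing_cvgn_le (series_sqnormc_nd x) cx N. Qed.

Lemma series_sqnormc_bound x (M : R) :
  (forall N, series (sqnormc x) N <= M) ->
  cvgn (series (sqnormc x)) /\ limn (series (sqnormc x)) <= M.
Proof.
move=> xM; have cx : cvgn (series (sqnormc x)).
  apply: nondecreasing_is_cvgn; first exact: series_sqnormc_nd.
  by exists M => _ [n _ <-].
by split=> //; apply: limr_le => //; exact: nearW.
Qed.

Lemma series_sqnormc_lin a (x y : nat -> C) N :
  series (sqnormc (a *: x + y)) N <=
  2 * (normc a ^+ 2 * series (sqnormc x) N + series (sqnormc y) N).
Proof.
rewrite /series /= (mulr_sumr _ _ _ (normc a ^+ 2)) -big_split mulr_sumr /=.
apply: ler_sum => i _; rewrite /sqnormc.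
apply: (@le_trans _ _ ((normc a * normc (x i) + normc (y i)) ^+ 2)).
  rewrite ler_sqr ?nnegrE ?addr_ge0 ?mulr_ge0 ?normc_ge0//.
  by rewrite -normcM; exact: le_normcD.
rewrite -exprMn; set u := _ * _; set v := normc _.
by have := sqr_ge0 (u - v); nra.
Qed.

Lemma sq_summable_submod : submod_closed sq_summable.
Proof.
split.
  apply/sq_summableP; apply: (proj1 (@series_sqnormc_bound _ 0 _)) => N.
  rewrite /series /= big1// => i _.
  by rewrite /sqnormc (_ : (0 : nat -> C) i = 0)// normc0 expr0n.
move=> a x y /sq_summableP cx /sq_summableP cy; apply/sq_summableP.
apply: (proj1 (@series_sqnormc_bound _ (2 * (normc a ^+ 2 *
  limn (series (sqnormc x)) + limn (series (sqnormc y)))) _)) => N.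
apply: (le_trans (series_sqnormc_lin _ _ _ _)).
rewrite ler_pM2l// lerD ?series_sqnormc_le//.
by rewrite ler_wpM2l ?sqr_ge0// series_sqnormc_le.
Qed.
HB.instance Definition _ :=
  GRing.isSubmodClosed.Build _ _ sq_summable sq_summable_submod.

Record ell2 := Ell2 { ell2_val :> nat -> C; ell2_valP : ell2_val \in sq_summable }.
HB.instance Definition _ := [isSub for ell2_val].
HB.instance Definition _ := [Choice of ell2 by <:].
HB.instance Definition _ := [SubChoice_isSubLmodule of ell2 by <:].

Definition l2norm (x : ell2) : R := Num.sqrt (limn (series (sqnormc x))).

Lemma l2norm_ge0 x : 0 <= l2norm x.
Proof. exact: sqrtr_ge0. Qed.

Lemma sqr_l2norm x : l2norm x ^+ 2 = limn (series (sqnormc x)).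
Proof.
rewrite sqr_sqrtr//; apply: le_trans (@series_sqnormc_le x 0%N _).
  by rewrite /series /= big_geq.
exact/sq_summableP/ell2_valP.
Qed.

Lemma sum_sqnormc_le (x : ell2) N : series (sqnormc x) N <= l2norm x ^+ 2.
Proof.
by rewrite sqr_l2norm series_sqnormc_le//; exact/sq_summableP/ell2_valP.
Qed.

Lemma l2norm_bound (x : ell2) (M : R) : 0 <= M ->
  (forall N, series (sqnormc x) N <= M ^+ 2) -> l2norm x <= M.
Proof.
move=> M0 xM; rewrite -ler_sqr ?nnegrE ?l2norm_ge0// sqr_l2norm.
by case: (series_sqnormc_bound xM).
Qed.

Definition bounded_op : {pred ell2 -> ell2} :=
  mem [set T : ell2 -> ell2 | linear T /\
         exists M : R, forall x, l2norm (T x) <= M * l2norm x].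

Lemma bounded_opP T :
  reflect (linear T /\ exists M : R, forall x, l2norm (T x) <= M * l2norm x)
    (T \in bounded_op).
Proof. by apply: (iffP idP) => [/set_mem|?]; last exact: mem_set. Qed.

Lemma bounded_op_submod : submod_closed bounded_op.
Proof.
split.
  apply/bounded_opP; split; first by move=> a x y; rewrite scaler0 addr0.
  exists 0 => x; rewrite mul0r; apply: l2norm_bound => // N.
  rewrite /series /= big1 ?expr0n// => i _.
  by rewrite -[sqnormc _ i]/(normc (0 : C) ^+ 2) normc0 expr0n.
move=> a T S /bounded_opP[linT [M TM]] /bounded_opP[linS [N SN]].
apply/bounded_opP; split.
  move=> b x y.
  rewrite -[LHS]/(a *: T (b *: x + y) + S (b *: x + y)) linT linS.
  rewrite -[RHS]/(b *: (a *: T x + S x) + (a *: T y + S y)).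
  by rewrite !scalerDr !scalerA mulrC addrACA.
have sqle K (z w : ell2) : l2norm z <= K * l2norm w ->
    l2norm z ^+ 2 <= K ^+ 2 * l2norm w ^+ 2.
  move=> zw; have K0 := le_trans (l2norm_ge0 _) zw.
  by rewrite -exprMn ler_sqr ?nnegrE ?l2norm_ge0.
have K0 : 0 <= 2 * (normc a ^+ 2 * M ^+ 2 + N ^+ 2).
  apply: mulr_ge0 => //; apply: addr_ge0; last exact: sqr_ge0.
  by apply: mulr_ge0; exact: sqr_ge0.
exists (Num.sqrt (2 * (normc a ^+ 2 * M ^+ 2 + N ^+ 2))) => x.
apply: l2norm_bound => [|n]; first by rewrite mulr_ge0 ?sqrtr_ge0 ?l2norm_ge0.
rewrite exprMn sqr_sqrtr//.
apply: (le_trans (series_sqnormc_lin a (T x) (S x) n)).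
rewrite -[leRHS]mulrA ler_pM2l// mulrDl lerD//.
  rewrite -[leRHS]mulrA; apply: ler_wpM2l; first exact: sqr_ge0.
  exact: le_trans (sum_sqnormc_le _ _) (sqle _ _ _ (TM x)).
exact: le_trans (sum_sqnormc_le _ _) (sqle _ _ _ (SN x)).
Qed.
HB.instance Definition _ :=
  GRing.isSubmodClosed.Build _ _ bounded_op bounded_op_submod.

Record bop := Bop { bop_val :> ell2 -> ell2; bop_valP : bop_val \in bounded_op }.
HB.instance Definition _ := [isSub for bop_val].
HB.instance Definition _ := [Choice of bop by <:].
HB.instance Definition _ := [SubChoice_isSubLmodule of bop by <:].

Lemma bop_ext (T S : bop) : (forall x n, T x n = S x n) -> T = S.
Proof.
move=> TS; apply/val_inj/funext => x; apply/val_inj/funext => n; exact: TS.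
Qed.

Lemma bop_linear (T : bop) : linear T.
Proof. by have /bounded_opP[] := bop_valP T. Qed.

Lemma idfun_bounded : (idfun : ell2 -> ell2) \in bounded_op.
Proof. by apply/bounded_opP; split=> //; exists 1 => x; rewrite mul1r. Qed.

Lemma comp_bounded (T S : bop) : (T \o S : ell2 -> ell2) \in bounded_op.
Proof.
have /bounded_opP[linT [M TM]] := bop_valP T.
have /bounded_opP[linS [N SN]] := bop_valP S.
apply/bounded_opP; split; first by move=> a x y /=; rewrite linS linT.
exists (`|M| * N) => x /=.
apply: (le_trans (TM _)); apply: (@le_trans _ _ (`|M| * l2norm (S x))).
  by rewrite ler_wpM2r ?l2norm_ge0// ler_norm.
by rewrite -mulrA ler_wpM2l.
Qed.

Definition bop_one : bop := Bop idfun_bounded.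
Definition bop_mul (T S : bop) : bop := Bop (comp_bounded T S).

Lemma bop_mulA : associative bop_mul.
Proof. by move=> T S U; exact: bop_ext. Qed.
Lemma bop_mul1l : left_id bop_one bop_mul.
Proof. by move=> T; exact: bop_ext. Qed.
Lemma bop_mul1r : right_id bop_one bop_mul.
Proof. by move=> T; exact: bop_ext. Qed.
Lemma bop_mulDl : left_distributive bop_mul +%R.
Proof. by move=> T S U; exact: bop_ext. Qed.
Lemma bop_mulDr : right_distributive bop_mul +%R.
Proof.
move=> T S U; apply: bop_ext => x n.
have /(_ 1 (S x) (U x)) := @bop_linear T; rewrite !scale1r => e.
by rewrite -[LHS]/((T (S x + U x) : nat -> C) n) e.
Qed.

HB.instance Definition _ := GRing.Zmodule_isPzRing.Build bop
  bop_mulA bop_mul1l bop_mul1r bop_mulDl bop_mulDr.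

(* Partial sums of |x_(f^dagger n)|^2 are bounded by those of |x_n|^2 since   *)
(* f^dagger is injective.                                                   *)
Lemma series_push_le (f : Emb) (x : ell2) N :
  series (sqnormc (push f x)) N <= l2norm x ^+ 2.
Proof.
pose s := pmap (emb_inv f) (iota 0 N).
have us : uniq s.
  rewrite /s; elim: (iota 0 N) (iota_uniq 0 N) => //= n t IH /andP[nt ut].
  case fn: (emb_inv_fun f n) => [k|]/=; last exact: IH.
  rewrite IH// andbT mem_pmap; apply: contra nt => /mapP[m mt fm].
  by rewrite (@emb_inj (emb_inv f) n m k).
have -> : series (sqnormc (push f x)) N = \sum_(m <- s) sqnormc x m.
  rewrite /series /= /index_iota subn0 /s; elim: (iota 0 N) => [|n t IH].
    by rewrite !big_nil.
  rewrite big_cons IH (_ : pmap _ (n :: t) =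
    oapp (cons^~ (pmap (emb_inv f) t)) (pmap (emb_inv f) t) (emb_inv f n))//.
  rewrite {1}/sqnormc /push; case: (emb_inv f n) => [k|].
    by rewrite [oapp _ _ _]/= big_cons.
  by rewrite normc0 expr0n add0r.
pose K := (\max_(m <- s) m).+1.
apply: le_trans (sum_sqnormc_le x K).
have sub : {subset s <= iota 0 K}.
  by move=> m ms; rewrite mem_iota add0n /K ltnS /=; exact: leq_bigmax_seq.
have <- : \sum_(m <- iota 0 K | m \in s) sqnormc x m = \sum_(m <- s) sqnormc x m.
  rewrite -big_filter; apply: perm_big; apply: uniq_perm => //.
    by rewrite filter_uniq// iota_uniq.
  by move=> m; rewrite mem_filter; case ms : (m \in s) => //=; exact: sub.
rewrite /series /= /index_iota subn0 [leRHS](bigID (mem s) xpredT)/=.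
by rewrite lerDl sumr_ge0// => m _; exact: sqnormc_ge0.
Qed.

Lemma push_summable (f : Emb) (x : ell2) : push f x \in sq_summable.
Proof.
by apply/sq_summableP; case: (series_sqnormc_bound (series_push_le f x)).
Qed.

(* U_f sends e_n to e_(f n), see emb_op_basis; on a general x it is given by  *)
(* the same formula as the action of f on l^infty.                           *)
Definition emb_op_fun (f : Emb) (x : ell2) : ell2 := Ell2 (push_summable f x).

Lemma emb_op_bounded f : emb_op_fun f \in bounded_op.
Proof.
apply/bounded_opP; split.
  move=> a x y; apply/val_inj/funext => n.
  rewrite -[LHS]/(push f (a *: x + y) n) -[RHS]/(a * push f x n + push f y n).
  by rewrite /push; case: (emb_inv f n) => [k|]; [|rewrite mulr0 addr0].
exists 1 => x; rewrite mul1r; apply: l2norm_bound; first exact: l2norm_ge0.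
exact: series_push_le.
Qed.

Definition emb_op (f : Emb) : bop := Bop (emb_op_bounded f).

Lemma series_diag_le (a : linf) (x : ell2) (M : R) N :
  (forall n, normc (a n) <= M) ->
  series (sqnormc (fun n => a n * x n)) N <= (M * l2norm x) ^+ 2.
Proof.
move=> aM; rewrite exprMn.
apply: (@le_trans _ _ (M ^+ 2 * series (sqnormc x) N)).
  rewrite /series /= mulr_sumr; apply: ler_sum => i _.
  rewrite /sqnormc normcM exprMn ler_wpM2r ?sqr_ge0//.
  by rewrite lerXn2r ?nnegrE ?normc_ge0//; apply: le_trans (aM i); exact: normc_ge0.
by rewrite ler_wpM2l ?sqr_ge0// sum_sqnormc_le.
Qed.

Lemma diag_summable (a : linf) (x : ell2) :
  (fun n => a n * x n) \in sq_summable.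
Proof.
have /bounded_seqP[M aM] := linf_valP a.
by apply/sq_summableP;
   case: (series_sqnormc_bound (fun N => series_diag_le x N aM)).
Qed.

Definition diag_op_fun (a : linf) (x : ell2) : ell2 := Ell2 (diag_summable a x).

Lemma diag_op_bounded a : diag_op_fun a \in bounded_op.
Proof.
have /bounded_seqP[M aM] := linf_valP a.
apply/bounded_opP; split.
  move=> b x y; apply/val_inj/funext => n.
  rewrite -[LHS]/(a n * (b * x n + y n)) -[RHS]/(b * (a n * x n) + a n * y n).
  by ring.
exists M => x; apply: l2norm_bound => [|N]; last exact: series_diag_le.
by rewrite mulr_ge0 ?l2norm_ge0//; apply: le_trans (aM 0%N); exact: normc_ge0.
Qed.

Definition diag_op (a : linf) : bop := Bop (diag_op_bounded a).

Lemma basis_summable (n : nat) : (fun m => (m == n)%:R : C) \in sq_summable.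
Proof.
apply/sq_summableP.
apply: (proj1 (@series_sqnormc_bound _ 1 _)) => N; rewrite /series /=.
apply: (@le_trans _ _ (\sum_(0 <= k < N) (k == n)%:R)).
  by apply: ler_sum => i _; rewrite /sqnormc; case: eqP => _;
     rewrite ?normc0 ?normc1 ?expr0n ?expr1n.
rewrite -natr_sum (_ : (\sum_(0 <= k < N) (k == n))%N =
  count_mem n (index_iota 0 N)).
  by rewrite count_uniq_mem ?iota_uniq// lern1 leq_b1.
by rewrite -sum1_count [RHS]big_mkcond; apply: eq_bigr => k _ /=; case: eqP.
Qed.
Definition basis (n : nat) : ell2 := Ell2 (basis_summable n).

Lemma emb_op_basis f n :
  emb_op f (basis n) = if f n is Some m then basis m else 0.
Proof.
apply/val_inj/funext => m.
rewrite -[LHS]/(if emb_inv f m is Some k then (k == n)%:R else 0 : C).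
case fm: (emb_inv f m) => [k|]; case fn: (f n) => [j|] //=.
- have fk := (emb_inv_funE f k m).1 fm.
  congr ((nat_of_bool _)%:R : C); apply/eqP/eqP => [kn|mj].
    by move: fk; rewrite kn fn => -[].
  by apply: emb_inj fk _; rewrite fn mj.
- case: eqP => // kn.
  by have := (emb_inv_funE f k m).1 fm; rewrite kn fn.
- case: eqP => // mj; move: fn; rewrite -mj => /(emb_inv_funE f n m).2.
  by move: fm => /= ->.
Qed.

Lemma diag_op_basis (a : linf) n : diag_op a (basis n) = a n *: basis n.
Proof.
apply/val_inj/funext => m; rewrite -[RHS]/(a n * (m == n)%:R) /=.
by case: eqP => [->//|_]; rewrite !mulr0.
Qed.

Definition Gamma : set bop :=
  lin_span [set T | exists (a : linf) (f : Emb), T = diag_op a * emb_op f].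

Definition symmetric_ideals : set (set linf) :=
  [set S | is_ideal setT S /\ forall f : Emb, linf_push f @` S `<=` S].

Definition I_of (S : set linf) : set bop :=
  lin_span [set T | exists (a : linf) (f : Emb), S a /\ T = diag_op a * emb_op f].

Definition S_of (I : set bop) : set linf := [set a | I (diag_op a)].

Definition J_of (S : set linf) : set bop := ideal_gen (diag_op @` S).

End sequences.

Arguments Gamma R : clear implicits.
Arguments symmetric_ideals R : clear implicits.

(* Main.v *)
(* Part (i): the rows and columns of T in Gamma have a bounded number of      *)
(* nonzero entries, so greedy colourings of the row and column indices cut T  *)
(* into finitely many blocks P_l T P_k (P_k diagonal projections) of the form *)
(* diag a * U_g; if T lies in an ideal, so do the blocks and the diag a.      *)
(*                                                                            *)
(* An ideal J of B is generated by its diagonal operators, without any        *)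
(* spectral theorem: the Lanczos process for A = T^* T, repeated on the       *)
(* orthogonal complements, gives an orthonormal basis in which A is a direct  *)
(* sum of tridiagonal matrices.  On the basis vectors of one parity A is      *)
(* diagonal, so T maps them to an orthogonal family; hence                    *)
(* T = Q0 D0 W0^* + Q1 D1 W1^* with D_p = Q_p^* T W_p diagonal.               *)
(*                                                                            *)
(* Finally diag a in J_S forces a in S: then |diag a x| <= |diag b (B x)| for *)
(* some b in S and some bounded B, so a dimension count bounds the number of  *)
(* n with |a n| >= s by the number of n with |b n| > t, for s > |B| t.  If    *)
(* these level sets are finite, matching them yields a partial injection f    *)
(* with |a| <= K |f_* b|; otherwise 1 is in S.                                *)

From Pilot Require Import Defs.
From mathcomp Require Import all_boot all_order all_algebra.
From mathcomp Require Import complex ring lra.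
From mathcomp Require Import boolp classical_sets functions reals topology.
From mathcomp Require Import normedtype sequences.
Import Pilot.Defs.
Import Order.TTheory GRing.Theory Num.Theory.
Import numFieldNormedType.Exports.
Import Normc.

Set Implicit Arguments.
Unset Strict Implicit.
Unset Printing Implicit Defensive.

Local Open Scope classical_set_scope.
Local Open Scope ring_scope.

(** * The inner product of l^2 *)

(** All three parts reduce to one principle: an ideal is determined by the diagonal operators it
    contains, and these are not enlarged by passing to a bigger algebra. Within [Gamma] this is part
    (i): [I_of_S_of] rebuilds an ideal from its diagonals and [S_of_I_of] shows that [I_of S] has no
    diagonals outside those of [S]. The analytic core is that the ideal of B generated by the
    diagonals of [S] acquires none either ([dominated_diag], [S_of_J_of]). Its intersection with
    [Gamma] is then an ideal of [Gamma] whose symmetric ideal is [S], and part (i) identifies it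
    with [I_of S]; this is (iii). For (ii), an ideal [I] of [Gamma] with [S = S_of I] is, by (i) and
    (iii), the intersection of [J_of S] with [Gamma]. So the ideal of B generated by [I] lies in
    [J_of S] and meets [Gamma] in [I] only. Conversely an ideal of B is recovered from its
    intersection with [Gamma] because [diagonalization] writes every bounded operator [T] as a sum
    of two products through diagonal operators, each of which is itself a product with factor
    [T]. *)

Section inner_product.
Variable R : realType.
Local Notation C := R[i].
Local Notation ell2 := (ell2 R).
Implicit Types (z w : nat -> C) (x y : ell2) (a : C).

Lemma normc_Re (c : C) : `|complex.Re c| <= normc c.
Proof.
by case: c => a b /=; rewrite -sqrtr_sqr ler_wsqrtr// lerDl sqr_ge0.
Qed.

Lemma normc_Im (c : C) : `|complex.Im c| <= normc c.
Proof.
by case: c => a b /=; rewrite -sqrtr_sqr ler_wsqrtr// lerDr sqr_ge0.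
Qed.

Lemma mulc_conjc (c : C) : c * conjc c = (normc c ^+ 2)%:C%C.
Proof.
case: c => a b /=; rewrite sqr_sqrtr ?addr_ge0 ?sqr_ge0//.
by rewrite /GRing.mul /=; congr Complex; ring.
Qed.

Lemma normc_conjc (c : C) : normc (conjc c) = normc c.
Proof. by case: c => a b /=; rewrite sqrrN. Qed.

(** Real and imaginary parts are summed separately so that results on real series apply. *)
Definition csum z : C :=
  Complex (limn (series (fun n => complex.Re (z n))))
          (limn (series (fun n => complex.Im (z n)))).

Definition csummable z := cvgn (series (fun n => normc (z n))).

Lemma csummable_Re z : csummable z -> cvgn (series (fun n => complex.Re (z n))).
Proof.
move=> cz; apply: normed_cvg; apply: series_le_cvg cz => n //=.
- exact: normc_ge0.
- exact: normc_Re.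
Qed.

Lemma csummable_Im z : csummable z -> cvgn (series (fun n => complex.Im (z n))).
Proof.
move=> cz; apply: normed_cvg; apply: series_le_cvg cz => n //=.
- exact: normc_ge0.
- exact: normc_Im.
Qed.

Lemma lim_series_lin (r s : R) (f g h : nat -> R) :
  cvgn (series f) -> cvgn (series g) -> cvgn (series h) ->
  limn (series (fun n => r * f n + s * g n + h n)) =
  r * limn (series f) + s * limn (series g) + limn (series h).
Proof.
move=> cf cg ch.
have crf : cvgn (series (r *: f)) by exact: is_cvg_seriesZ.
have csg : cvgn (series (s *: g)) by exact: is_cvg_seriesZ.
have := lim_seriesD (is_cvg_seriesD crf csg) ch.
by rewrite (lim_seriesD crf csg) (lim_seriesZ r cf) (lim_seriesZ s cg).
Qed.

Lemma csum_lin a z w : csummable z -> csummable w ->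
  csum (fun n => a * z n + w n) = a * csum z + csum w.
Proof.
move=> cz cw; have [rz iz] := (csummable_Re cz, csummable_Im cz).
have [rw iw] := (csummable_Re cw, csummable_Im cw).
rewrite /csum; case: a => a b.
transitivity (Complex
  (a * limn (series (fun n => complex.Re (z n))) +
   (- b) * limn (series (fun n => complex.Im (z n))) +
   limn (series (fun n => complex.Re (w n))))
  (a * limn (series (fun n => complex.Im (z n))) +
   b * limn (series (fun n => complex.Re (z n))) +
   limn (series (fun n => complex.Im (w n))))).
  rewrite -!lim_series_lin//; congr Complex; congr (limn (series _));
    apply/funext => n; case: (z n) (w n) => p q [u v] //=.
  by rewrite mulNr.
by rewrite mulNr.
Qed.

Lemma csum_conjc z : csummable z -> csum (fun n => conjc (z n)) = conjc (csum z).
Proof.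
move=> /csummable_Im iz; rewrite /csum; congr Complex.
  by congr (limn (series _)); apply/funext => n; case: (z n).
rewrite -lim_seriesN//; congr (limn (series _)).
by apply/funext => n; rewrite !fctE; case: (z n).
Qed.

Lemma csum_real (r : nat -> R) :
  csum (fun n => (r n)%:C%C) = (limn (series r))%:C%C.
Proof.
rewrite /csum /=; congr Complex; rewrite (_ : series _ = fun=> 0) ?lim_cst//.
by apply/funext => n; rewrite /series /= big1.
Qed.

Lemma csum_single z n : (forall m, m != n -> z m = 0) -> csum z = z n.
Proof.
move=> z0; have limE (f : nat -> R) : (forall m, m != n -> f m = 0) ->
    limn (series f) = f n.
  move=> f0; apply: (@lim_near_cst R^o) => //; exists n.+1 => //= N nN.
  rewrite /series /= (bigD1_seq n) ?iota_uniq ?mem_index_iota//=.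
  by rewrite big1 ?addr0.
by rewrite /csum !limE; [case: (z n)|move=> m /z0->|move=> m /z0->].
Qed.

Definition dot x y : C := csum (fun n => x n * conjc (y n)).

Lemma dot_summable x y : csummable (fun n => x n * conjc (y n)).
Proof.
have cx : cvgn (series (sqnormc x)) by exact/sq_summableP/ell2_valP.
have cy : cvgn (series (sqnormc y)) by exact/sq_summableP/ell2_valP.
apply: (@series_le_cvg _ _ (sqnormc x + sqnormc y)).
- by move=> n; exact: normc_ge0.
- by move=> n; rewrite addr_ge0 ?sqnormc_ge0.
- move=> n; rewrite normcM normc_conjc !fctE /sqnormc.
  by have := sqr_ge0 (normc (x n) - normc (y n));
    have := normc_ge0 (x n); have := normc_ge0 (y n); nra.
- exact: is_cvg_seriesD.
Qed.

Lemma dot_lin a x y v : dot (a *: x + y) v = a * dot x v + dot y v.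
Proof.
rewrite /dot -csum_lin; try exact: dot_summable.
by congr csum; apply/funext => n; rewrite mulrA -mulrDl.
Qed.

Lemma dotC x y : dot y x = conjc (dot x y).
Proof.
rewrite /dot -csum_conjc; last exact: dot_summable.
by congr csum; apply/funext => n; rewrite rmorphM /= conjcK mulrC.
Qed.

Lemma dotDl x y v : dot (x + y) v = dot x v + dot y v.
Proof. by have := dot_lin 1 x y v; rewrite scale1r mul1r. Qed.

Lemma dot0l v : dot 0 v = 0.
Proof. by apply: (addrI (dot 0 v)); rewrite -dotDl !addr0. Qed.

Lemma dotZl a x v : dot (a *: x) v = a * dot x v.
Proof. by have := dot_lin a x 0 v; rewrite dot0l !addr0. Qed.

Lemma dotNl x v : dot (- x) v = - dot x v.
Proof. by rewrite -scaleN1r dotZl mulN1r. Qed.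

Lemma dotBl x y v : dot (x - y) v = dot x v - dot y v.
Proof. by rewrite dotDl dotNl. Qed.

Lemma dotDr v x y : dot v (x + y) = dot v x + dot v y.
Proof. by rewrite (dotC (x + y)) dotDl rmorphD (dotC x) (dotC y). Qed.

Lemma dotZr a v x : dot v (a *: x) = conjc a * dot v x.
Proof. by rewrite (dotC (a *: x)) dotZl rmorphM (dotC x). Qed.

Lemma dot0r v : dot v 0 = 0.
Proof. by rewrite dotC dot0l conjc0. Qed.

Lemma dotBr v x y : dot v (x - y) = dot v x - dot v y.
Proof. by rewrite (dotC (x - y)) dotBl rmorphB (dotC x) (dotC y). Qed.

Lemma dot_suml I (s : seq I) (F : I -> ell2) v :
  dot (\sum_(i <- s) F i) v = \sum_(i <- s) dot (F i) v.
Proof. by elim: s => [|i s IH]; rewrite ?big_nil ?dot0l// !big_cons dotDl IH. Qed.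

Lemma dot_basis x n : dot x (basis R n) = x n.
Proof.
rewrite /dot (csum_single (n := n)) /= ?eqxx ?conjc1 ?mulr1// => m /negPf->.
by rewrite conjc0 mulr0.
Qed.

Lemma dot_normE x : dot x x = (l2norm x ^+ 2)%:C%C.
Proof.
rewrite sqr_l2norm -csum_real; congr csum; apply/funext => n.
exact: mulc_conjc.
Qed.

Lemma normc_le_l2norm x n : normc (x n) <= l2norm x.
Proof.
rewrite -ler_sqr ?nnegrE ?normc_ge0 ?l2norm_ge0//.
apply: le_trans (sum_sqnormc_le x n.+1).
by rewrite /series /= big_nat_recr//= lerDr sumr_ge0// => i _; exact: sqnormc_ge0.
Qed.

Lemma l2norm0_eq0 x : l2norm x = 0 -> x = 0.
Proof.
move=> x0; apply/val_inj/funext => n; apply: eq0_normc.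
by apply/eqP; rewrite eq_le normc_ge0 andbT -x0 normc_le_l2norm.
Qed.

Lemma l2norm_0 : l2norm (0 : ell2) = 0.
Proof.
have := dot_normE 0; rewrite dot0l => -[] /esym/eqP.
by rewrite expf_eq0 /= => /eqP.
Qed.

Lemma dot_eq0 x : dot x x = 0 -> x = 0.
Proof.
rewrite dot_normE => -[] /eqP; rewrite expf_eq0 /= => /eqP.
exact: l2norm0_eq0.
Qed.

Lemma l2normZ a x : l2norm (a *: x) = normc a * l2norm x.
Proof.
apply/eqP; rewrite -(@eqrXn2 _ 2) ?mulr_ge0 ?l2norm_ge0 ?normc_ge0//.
apply/eqP/complexI; rewrite -dot_normE dotZl dotZr mulrA mulc_conjc dot_normE.
by rewrite -rmorphM /= exprMn.
Qed.

Lemma CauchySchwarz_l2 x y : normc (dot x y) <= l2norm x * l2norm y.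
Proof.
have [/l2norm0_eq0->|y0] := eqVneq (l2norm y) 0.
  by rewrite dot0r normc0 mulr_ge0 ?l2norm_ge0.
set d := dot x y; set s := l2norm y ^+ 2.
have s0 : 0 < s by rewrite exprn_gt0// lt_def y0 l2norm_ge0.
(* [w] is [s] times the component of [x] orthogonal to [y]; the factor [s] avoids a division. *)
pose w := s%:C%C *: x - d *: y.
have : dot w w = (s * (s * l2norm x ^+ 2 - normc d ^+ 2))%:C%C.
  rewrite /w !(dotBl, dotBr, dotZl, dotZr) (dotC x y) -/d !dot_normE -/s.
  have -> : (s * (s * l2norm x ^+ 2 - normc d ^+ 2))%:C%C =
      s%:C%C * (s%:C%C * (l2norm x ^+ 2)%:C%C - d * conjc d).
    by rewrite mulc_conjc -!rmorphM -rmorphB -rmorphM.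
  by rewrite conjc_real; ring.
rewrite dot_normE => -[] ww; have := sqr_ge0 (l2norm w).
rewrite ww pmulr_rge0// subr_ge0 => le.
by rewrite -ler_sqr ?nnegrE ?mulr_ge0 ?l2norm_ge0 ?normc_ge0// exprMn mulrC.
Qed.

Lemma l2normD x y : l2norm (x + y) <= l2norm x + l2norm y.
Proof.
rewrite -ler_sqr ?nnegrE ?addr_ge0 ?l2norm_ge0//.
have : dot (x + y) (x + y) =
    (l2norm x ^+ 2 + 2 * complex.Re (dot x y) + l2norm y ^+ 2)%:C%C.
  rewrite dotDl !dotDr !dot_normE (dotC x y) addrA -(addrA (_ %:C)%C) addcJ.
  by rewrite !rmorphD (rmorphM _ 2) (rmorph_nat _ 2).
rewrite dot_normE => -[] ->.
have := le_trans (ler_norm _) (le_trans (normc_Re (dot x y)) (CauchySchwarz_l2 x y)).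
by move=> le; rewrite sqrrD lerD2r lerD2l mulr_natl lerMn2r.
Qed.

End inner_product.

(** * Bounded operators and adjoints *)

Section operators.
Variable R : realType.
Local Notation C := R[i].
Local Notation ell2 := (ell2 R).
Local Notation bop := (bop R).
Local Notation basis := (basis R).
Implicit Types (x y : ell2) (z : nat -> C) (a : C) (T S : bop).

Lemma bopD T x y : T (x + y) = T x + T y.
Proof. by have := bop_linear T 1 x y; rewrite !scale1r. Qed.

Lemma bop_at0 T : T 0 = 0.
Proof. by apply: (addrI (T 0)); rewrite -bopD !addr0. Qed.

Lemma bopZ T a x : T (a *: x) = a *: T x.
Proof. by have := bop_linear T a x 0; rewrite bop_at0 !addr0. Qed.

Lemma bopN T x : T (- x) = - T x.
Proof. by rewrite -scaleN1r bopZ scaleN1r. Qed.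

Lemma bopB T x y : T (x - y) = T x - T y.
Proof. by rewrite bopD bopN. Qed.

Lemma bop_sum T I (s : seq I) (F : I -> ell2) :
  T (\sum_(i <- s) F i) = \sum_(i <- s) T (F i).
Proof.
by elim: s => [|i s IH]; rewrite ?big_nil ?bop_at0// !big_cons bopD IH.
Qed.

Lemma bopME T S x : (T * S) x = T (S x). Proof. by []. Qed.
Lemma bopDE T S x : (T + S) x = T x + S x. Proof. by []. Qed.
Lemma bopBE T S x : (T - S) x = T x - S x. Proof. by []. Qed.
Lemma bopZE a T x : (a *: T) x = a *: T x. Proof. by []. Qed.

Lemma bop_eqP T S : (forall x, T x = S x) -> T = S.
Proof. by move=> TS; apply: bop_ext => x n; rewrite TS. Qed.

Lemma bop_bound T : exists2 M : R, 0 < M & forall x, l2norm (T x) <= M * l2norm x.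
Proof.
have /bounded_opP[_ [M TM]] := bop_valP T.
exists (`|M| + 1) => [|x]; first by rewrite ltr_wpDl.
apply: le_trans (TM x) _; apply: ler_wpM2r; first exact: l2norm_ge0.
by apply: le_trans (ler_norm M) _; rewrite lerDl.
Qed.

Lemma ell2_ext x y : (forall n, x n = y n) -> x = y.
Proof. by move=> xy; apply/val_inj/funext. Qed.

Lemma basisE n m : basis n m = (m == n)%:R. Proof. by []. Qed.

Lemma dot_basisr n x : dot (basis n) x = conjc (x n).
Proof. by rewrite dotC dot_basis. Qed.

Definition trunc N (z : nat -> C) : ell2 := \sum_(0 <= n < N) z n *: basis n.

Lemma truncE N z m : trunc N z m = if (m < N)%N then z m else 0.
Proof.
rewrite -(dot_basis (trunc N z)) dot_suml; case: ifPn => [mN|].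
  rewrite (bigD1_seq m) ?iota_uniq ?mem_index_iota//= dotZl dot_basis basisE eqxx.
  rewrite mulr1 big1 ?addr0// => n nm.
  by rewrite dotZl dot_basis basisE eq_sym (negPf nm) mulr0.
rewrite -leqNgt => Nm; rewrite big_seq big1// => n; rewrite mem_index_iota => nN.
rewrite dotZl dot_basis basisE; case: eqP => [mn|_]; last by rewrite mulr0.
by move: nN; rewrite -mn ltnNge Nm.
Qed.

Lemma dot_trunc N z y :
  dot (trunc N z) y = \sum_(0 <= n < N) z n * conjc (y n).
Proof.
by rewrite dot_suml; apply: eq_bigr => n _; rewrite dotZl dot_basisr.
Qed.

Lemma dot_trunc_sq N z y : (forall n, (n < N)%N -> y n = z n) ->
  dot (trunc N z) y = (series (sqnormc z) N)%:C%C.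
Proof.
move=> yz; rewrite dot_trunc /series /= raddf_sum /= [in LHS]big_seq [in RHS]big_seq.
by apply: eq_bigr => n; rewrite mem_index_iota => /yz ->; rewrite mulc_conjc.
Qed.

Lemma trunc_approx x (e : R) : 0 < e -> exists N, l2norm (x - trunc N x) < e.
Proof.
move=> e0; have cx : cvgn (series (sqnormc x)) by exact/sq_summableP/ell2_valP.
have e20 : 0 < e ^+ 2 by rewrite exprn_gt0.
have /cvgrPdist_lt /(_ _ e20)[N _ /(_ N (leqnn N))] := cx.
rewrite -sqr_l2norm ger0_norm ?subr_ge0 ?sum_sqnormc_le// => lt.
exists N; rewrite -ltr_sqr ?nnegrE ?l2norm_ge0 ?(ltW e0)//.
suff : dot (x - trunc N x) (x - trunc N x) =
    (l2norm x ^+ 2 - series (sqnormc x) N)%:C%C by rewrite dot_normE => -[] ->.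
rewrite dotBl !dotBr (dotC (trunc N x) x) !dot_trunc_sq//; last first.
  by move=> n nN; rewrite truncE nN.
by rewrite conjc_real subrr subr0 dot_normE rmorphB.
Qed.

(* A bounded functional on l^2 is determined by its values on the basis.     *)
Lemma dot_matrix T y (z : ell2) :
  (forall n, z n = dot y (T (basis n))) -> forall x, dot (T x) y = dot x z.
Proof.
move=> zE x; have [M M0 TM] := bop_bound T.
apply/eqP; rewrite -subr_eq0; apply/eqP/eq0_normc; apply/eqP.
rewrite eq_le normc_ge0 andbT; apply/ler_addgt0Pl => e e0; rewrite addr0.
pose K := M * l2norm y + l2norm z + 1.
have K0 : 0 < K.
  by rewrite ltr_wpDl// addr_ge0 ?l2norm_ge0// mulr_ge0 ?l2norm_ge0// ltW.
have [N xN] := trunc_approx x (divr_gt0 e0 K0).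
set w := x - trunc N x in xN.
(* The two functionals agree on the truncation of [x], so only the tail [w], of norm below [e / K],
   contributes. *)
have -> : dot (T x) y - dot x z = dot (T w) y - dot w z.
  suff E : dot (T (trunc N x)) y = dot (trunc N x) z.
    by rewrite /w bopB !dotBl E; ring.
  rewrite dot_trunc bop_sum dot_suml; apply: eq_bigr => n _.
  by rewrite bopZ dotZl zE (dotC y).
rewrite ltr_pdivlMr// in xN.
apply: le_trans (le_normcD _ _) _; rewrite normcN.
apply: le_trans (lerD (CauchySchwarz_l2 _ _) (CauchySchwarz_l2 _ _)) _.
apply: le_trans (ltW xN).
have := TM w; have := l2norm_ge0 w; have := l2norm_ge0 y; rewrite /K.
move: (l2norm (T w)) (l2norm w) (l2norm y) (l2norm z) => p q r s r0 q0 pq.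
have := ler_wpM2r r0 pq; nra.
Qed.

Lemma bop_basis_eq T S : (forall n, T (basis n) = S (basis n)) -> T = S.
Proof.
move=> TS; apply: bop_eqP => x; apply/eqP; rewrite -subr_eq0; apply/eqP.
apply: dot_eq0; rewrite -bopBE.
rewrite (@dot_matrix (T - S) ((T - S) x) 0) ?dot0r// => n.
by rewrite [(T - S) (basis n)]bopBE TS subrr dot0r.
Qed.

(** These are the coordinates which the adjoint relation forces on the image of [y]; no Riesz
    representation is invoked. *)
Definition adj_fun T y : nat -> C := fun n => dot y (T (basis n)).

(** Testing [T] on the truncation [w] of the sequence itself gives |w|^2 = <T w, y> <= M |w| |y|, so
    |w| <= M |y| for every [N]. *)
Lemma adj_bound T (M : R) : 0 <= M -> (forall x, l2norm (T x) <= M * l2norm x) ->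
  forall y N, series (sqnormc (adj_fun T y)) N <= (M * l2norm y) ^+ 2.
Proof.
move=> M0 TM y N; set s := series _ N.
have s0 : 0 <= s by rewrite sumr_ge0// => n _; exact: sqnormc_ge0.
pose w := trunc N (adj_fun T y).
have ww : dot w w = s%:C%C by apply: dot_trunc_sq => n nN; rewrite truncE nN.
have Tw : dot (T w) y = s%:C%C.
  rewrite /w bop_sum dot_suml /s /series /= raddf_sum /=; apply: eq_bigr => n _.
  by rewrite bopZ dotZl (dotC y) -/(adj_fun T y n) mulc_conjc.
have := CauchySchwarz_l2 (T w) y.
rewrite Tw /= expr0n addr0 sqrtr_sqr ger0_norm// => sle.
move: ww; rewrite dot_normE => -[] ww.
have {}sle : s <= M * l2norm y * l2norm w.
  apply: le_trans sle _; rewrite mulrAC ler_wpM2r ?l2norm_ge0//.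
rewrite -ww in sle *.
have [/eqP->|w0] := boolP (l2norm w == 0); first by rewrite expr0n sqr_ge0.
have {}w0 : 0 < l2norm w by rewrite lt_def w0 l2norm_ge0.
by rewrite ler_sqr ?nnegrE ?mulr_ge0 ?l2norm_ge0// -(ler_pM2r w0) -expr2.
Qed.

Lemma adj_summable T y : adj_fun T y \in @sq_summable R.
Proof.
have [M M0 TM] := bop_bound T; apply/sq_summableP.
by case: (series_sqnormc_bound (adj_bound (ltW M0) TM y)).
Qed.

Lemma adj_bounded T : (fun y => Ell2 (adj_summable T y)) \in @bounded_op R.
Proof.
have [M M0 TM] := bop_bound T; apply/bounded_opP; split.
  by move=> a x y; apply: ell2_ext => n; exact: dot_lin.
exists M => y; apply: l2norm_bound; last exact: adj_bound (ltW M0) TM y.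
by rewrite mulr_ge0 ?l2norm_ge0// ltW.
Qed.

Definition adj T : bop := Bop (adj_bounded T).

Lemma dot_adjr T x y : dot (T x) y = dot x (adj T y).
Proof. exact: dot_matrix. Qed.

Lemma dot_adjl T x y : dot x (T y) = dot (adj T x) y.
Proof. by rewrite dotC dot_adjr (dotC (adj T x)) conjcK. Qed.

Lemma ell2_dot_eq x y : (forall v, dot x v = dot y v) -> x = y.
Proof. by move=> xy; apply: ell2_ext => n; rewrite -!dot_basis xy. Qed.

Lemma adjK T : adj (adj T) = T.
Proof.
apply: bop_eqP => x; apply: ell2_dot_eq => v.
by rewrite -dot_adjl -dot_adjr.
Qed.

Lemma adjM T S : adj (T * S) = adj S * adj T.
Proof.
apply: bop_eqP => x; apply: ell2_dot_eq => v.
by rewrite -dot_adjl !bopME -!dot_adjl.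
Qed.

Lemma adjD T S : adj (T + S) = adj T + adj S.
Proof.
apply: bop_eqP => x; apply: ell2_dot_eq => v.
by rewrite -dot_adjl !bopDE dotDr dotDl -!dot_adjl.
Qed.

Lemma adj0 : adj 0 = 0.
Proof. by apply: (addrI (adj 0)); rewrite -adjD !addr0. Qed.

Lemma adjE T x n : adj T x n = dot x (T (basis n)). Proof. by []. Qed.

End operators.

(** * Orthonormal systems and the Lanczos process *)

Section orthonormal.
Variable R : realType.
Local Notation C := R[i].
Local Notation ell2 := (ell2 R).
Local Notation bop := (bop R).
Local Notation basis := (basis R).
Implicit Types (x y z : ell2) (A P T V : bop) (u v : nat -> ell2).

(* The second clause says that each v n is zero or a unit vector. *)
Definition orthonormal0 v : Prop :=
  (forall m n, m <> n -> dot (v m) (v n) = 0) /\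
  (forall n, dot (v n) (v n) *: v n = v n).

Lemma dotvv_conj x : conjc (dot x x) = dot x x.
Proof. by rewrite dot_normE conjc_real. Qed.

Lemma dot_mulvv x y : dot y y *: y = y -> dot x y * dot y y = dot x y.
Proof. by move=> yy; rewrite -[in RHS]yy dotZr dotvv_conj mulrC. Qed.

Lemma Bessel v x N : orthonormal0 v ->
  series (sqnormc (fun n => dot x (v n))) N <= l2norm x ^+ 2.
Proof.
move=> [ov nv]; set s := series _ N.
pose y : ell2 := \sum_(0 <= n < N) dot x (v n) *: v n.
have yv n : (n < N)%N -> dot y (v n) = dot x (v n).
  move=> nN; rewrite dot_suml (bigD1_seq n) ?iota_uniq ?mem_index_iota//=.
  rewrite dotZl dot_mulvv// big1 ?addr0// => m /eqP mn.
  by rewrite dotZl ov ?mulr0.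
have yx : dot y x = s%:C%C.
  rewrite dot_suml /s /series /= raddf_sum /=; apply: eq_bigr => n _.
  by rewrite dotZl (dotC x (v n)) mulc_conjc.
have yy : dot y y = s%:C%C.
  rewrite {1}/y dot_suml /s /series /= raddf_sum /= [LHS]big_seq [RHS]big_seq.
  apply: eq_bigr => n; rewrite mem_index_iota => /yv yvn.
  by rewrite dotZl (dotC y (v n)) yvn mulc_conjc.
have : dot (x - y) (x - y) = (l2norm x ^+ 2 - s)%:C%C.
  by rewrite dotBl !dotBr (dotC y x) yx yy conjc_real dot_normE subrr subr0 rmorphB.
rewrite dot_normE => -[] e; rewrite -subr_ge0 -e; exact: sqr_ge0.
Qed.

Lemma analysis_summable v x : orthonormal0 v ->
  (fun n => dot x (v n)) \in @sq_summable R.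
Proof.
move=> ov; apply/sq_summableP.
by case: (series_sqnormc_bound (fun N => Bessel x N ov)).
Qed.

(** The operator is the adjoint of the analysis map sending [x] to the sequence of its coefficients,
    a contraction by Bessel. *)
Lemma synthesis v : orthonormal0 v -> exists V, forall n, V (basis n) = v n.
Proof.
move=> ov; pose W x : ell2 := Ell2 (analysis_summable x ov).
have bW : W \in @bounded_op R.
  apply/bounded_opP; split.
    by move=> a x y; apply: ell2_ext => n; exact: dot_lin.
  exists 1 => x; rewrite mul1r; apply: l2norm_bound; first exact: l2norm_ge0.
  by move=> N; exact: Bessel.
exists (adj (Bop bW)) => n; apply: ell2_dot_eq => x.
by rewrite dotC -dot_adjr dot_basis [RHS]dotC.
Qed.

(** Zero columns being allowed, [V] is a partial isometry ([onb_proj]), and a system that spans only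
    finitely many dimensions is still indexed by all of nat. *)
Definition onb V := orthonormal0 (fun n => V (basis n)).

Lemma onb_adj V n : onb V -> adj V (V (basis n)) =
  dot (V (basis n)) (V (basis n)) *: basis n.
Proof.
move=> [ov _]; apply: ell2_ext => m; rewrite adjE.
rewrite -[RHS]/(_ * (m == n)%:R); case: eqP => [->|mn]; first by rewrite mulr1.
by rewrite mulr0 ov// => nm; apply: mn.
Qed.

Lemma onb_proj V : onb V -> V * adj V * V = V.
Proof.
move=> oV; apply: bop_basis_eq => n.
by rewrite !bopME onb_adj// bopZ; case: oV => _ ->.
Qed.

(** Since the inverse of 0 is 0, [nrm 0 = 0]: a linearly dependent vector in Gram-Schmidt simply
    yields a zero vector. *)
Definition nrm x : ell2 := ((l2norm x)^-1)%:C%C *: x.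

Lemma l2norm_nrm x : (l2norm x)%:C%C *: nrm x = x.
Proof.
have [/l2norm0_eq0 ->|x0] := eqVneq (l2norm x) 0; first by rewrite /nrm !scaler0.
by rewrite /nrm scalerA -rmorphM /= divff// scale1r.
Qed.

Lemma nrm_idem x : dot (nrm x) (nrm x) *: nrm x = nrm x.
Proof.
have [/l2norm0_eq0 ->|x0] := eqVneq (l2norm x) 0; first by rewrite /nrm !scaler0.
rewrite {1 2}/nrm dotZl dotZr conjc_real dot_normE -!rmorphM /=.
by rewrite (_ : _ * (_ * _) = 1) ?scale1r//; field.
Qed.

Definition residual (s : seq ell2) x : ell2 := x - \sum_(w <- s) dot x w *: w.

(** The input vector at each stage may depend on the outputs so far, as the Lanczos process
    requires. *)
Lemma gram_schmidt (next : seq ell2 -> ell2) : exists u, orthonormal0 u /\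
  forall n, u n = nrm (residual (mkseq u n) (next (mkseq u n))).
Proof.
pose gs s := nrm (residual s (next s)).
pose S n := iter n (fun s => rcons s (gs s)) [::].
pose u n := gs (S n).
have SE n : S n = mkseq u n by elim: n => //= n IH; rewrite mkseqS /u IH.
exists u; split; last by move=> n; rewrite {1}/u SE.
have idem n : dot (u n) (u n) *: u n = u n by exact: nrm_idem.
split=> //.
have ort n : forall i, (i < n)%N -> dot (u n) (u i) = 0.
  elim/ltn_ind: n => n IH i ni; rewrite {1}/u /gs SE /nrm dotZl.
  move: (_%:C)%C => c; set x := next _; rewrite /residual dotBl /mkseq big_map dot_suml.
  rewrite (bigD1_seq i) ?iota_uniq ?mem_iota//= dotZl dot_mulvv//.
  rewrite big_seq_cond big1 ?addr0 ?subrr ?mulr0// => j.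
  rewrite mem_iota /= add0n => /andP[nj]; rewrite neq_ltn dotZl => /orP[ji|ij].
    by rewrite (dotC (u i)) IH// conjc0 mulr0.
  by rewrite IH// mulr0.
move=> m n /eqP; rewrite neq_ltn => /orP[mn|nm]; last exact: ort.
by rewrite dotC ort// conjc0.
Qed.

(* Lanczos: Gram-Schmidt on z, A z, ...; self-adjointness of A makes its     *)
(* matrix in the resulting system tridiagonal.                               *)
Lemma lanczos A P z : P * A = A * P -> P z = 0 ->
  exists V, [/\ onb V, P * V = 0, (V * adj V) z = z,
    V * adj V * A * V = A * V &
    forall i j, (i.+1 < j)%N -> dot (A (V (basis i))) (V (basis j)) = 0].
Proof.
move=> PA Pz.
pose next (s : seq ell2) := if s is [::] then z else A (last 0 s).
have [u [ou uE]] := gram_schmidt next.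
have [V VE] := synthesis ou.
have oV : onb V.
  by case: ou => ou1 ou2; split=> [m n mn|n]; rewrite !VE//; exact: ou1.
have VVu n : (V * adj V) (u n) = u n by rewrite -VE -bopME onb_proj.
pose x n := next (mkseq u n).
have x0 : x 0%N = z by [].
have xS n : x n.+1 = A (u n) by rewrite /x mkseqS /next; case: mkseq => //= a s; rewrite last_rcons.
have xE n : x n = (l2norm (residual (mkseq u n) (x n)))%:C%C *: u n +
    \sum_(i <- iota 0 n) dot (x n) (u i) *: u i.
  by rewrite uE -/(x n) l2norm_nrm /residual /mkseq big_map subrK.
have Pu n : P (u n) = 0.
  elim/ltn_ind: n => n IH; rewrite uE /nrm bopZ -/(x n); move: (_%:C)%C => c.
  rewrite /residual bopB bop_sum /mkseq big_map big_seq big1 ?subr0 => [|i]; last first.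
    by rewrite mem_iota => /IH Pi; rewrite bopZ Pi scaler0.
  suff -> : P (x n) = 0 by rewrite scaler0.
  case: n IH => [|n] IH; first by rewrite x0.
  by rewrite xS -bopME PA bopME IH ?bop_at0.
have VVx n : (V * adj V) (x n) = x n.
  rewrite xE bopD bopZ VVu bop_sum; congr (_ + _).
  by apply: eq_bigr => i _; rewrite bopZ VVu.
exists V; split=> //.
- by apply: bop_basis_eq => n; rewrite bopME VE Pu.
- by rewrite -x0 VVx.
- by apply: bop_basis_eq => n; rewrite !bopME VE -xS -[RHS]VVx.
(* [A (u i)] is the input [x i.+1], hence a combination of [u 0], ..., [u i.+1], all orthogonal to
   [u j]. *)
- move=> i j ij; rewrite !VE -xS xE dotDl dotZl; case: ou => ou1 _.
  rewrite ou1 ?mulr0 ?add0r; last by move=> e; rewrite e ltnn in ij.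
  rewrite dot_suml big_seq big1// => k; rewrite mem_iota add0n => /andP[_ ki].
  rewrite dotZl ou1 ?mulr0// => e; move: (ltn_trans ki ij).
  by rewrite e ltnn.
Qed.

(** Lanczos is started at [x - P x], the part of [x] missed by the projection [P], so that the
    enlarged projection fixes [x] and still commutes with [A]. *)
Lemma reducing_step A P x : adj A = A -> adj P = P -> P * P = P -> P * A = A * P ->
  exists V, [/\ onb V, P * V = 0,
   forall i j, (i.+1 < j)%N -> dot (A (V (basis i))) (V (basis j)) = 0,
   (P + V * adj V) x = x & let P' := P + V * adj V in
   [/\ adj P' = P', P' * P' = P' & P' * A = A * P']].
Proof.
move=> sA sP PP PA.
have [|V [oV PV Vz VAV tri]] := @lanczos A P (x - P x) PA.
  by rewrite bopB -bopME PP subrr.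
have VVV := onb_proj oV.
pose Q := V * adj V.
have sQ : adj Q = Q by rewrite /Q adjM adjK.
have QQ : Q * Q = Q by rewrite /Q mulrA VVV.
have PQ : P * Q = 0 by rewrite /Q mulrA PV mul0r.
have QP : Q * P = 0 by rewrite -sQ -sP -adjM PQ adj0.
have QAQ : Q * A * Q = A * Q by rewrite [in LHS]/Q mulrA VAV mulrA.
(* Taking adjoints in the invariance [Q * A * Q = A * Q] gives [Q * A * Q = Q * A]. *)
have QA : Q * A = A * Q.
  by have := congr1 (@adj R) QAQ; rewrite (adjM (Q * A)) (adjM Q A) (adjM A) sA sQ mulrA QAQ.
exists V; split=> //.
  have Qx : Q x = x - P x.
    by rewrite -[in LHS](subrK (P x) x) bopD Vz -[Q (P x)]bopME QP addr0.
  by rewrite bopDE Qx addrC subrK.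
split; rewrite -/Q.
- by rewrite adjD sP sQ.
- by rewrite mulrDl !mulrDr PP QQ PQ QP addr0 add0r.
- by rewrite mulrDl mulrDr PA QA.
Qed.

(** [reducing_step] is iterated from the zero projection, round [k] absorbing [basis k]; the finite
    sums in the last clause express completeness without any limit of operators. *)
Lemma reducing_sequence A : adj A = A -> exists V : nat -> bop,
  [/\ forall k, onb (V k),
      forall k l, k <> l -> adj (V l) * V k = 0 /\ adj (V l) * A * V k = 0,
      forall k i j, (i.+1 < j)%N ->
        dot (A (V k (basis i))) (V k (basis j)) = 0 &
      forall k, (\sum_(l < k.+1) V l * adj (V l)) (basis k) = basis k].
Proof.
move=> sA.
pose good P := [/\ adj P = P, P * P = P & P * A = A * P].
(* The condition on the projection sits under the [exists], so that choice gives a total function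
   usable in a recursion. *)
have : forall Pk : bop * nat, exists V, good Pk.1 -> [/\ onb V, Pk.1 * V = 0,
   forall i j, (i.+1 < j)%N -> dot (A (V (basis i))) (V (basis j)) = 0,
   (Pk.1 + V * adj V) (basis Pk.2) = basis Pk.2 & good (Pk.1 + V * adj V)].
  move=> [P k] /=; have [[sP PP PA]|nP] := pselect (good P); last by exists 0.
  by have [V HV] := reducing_step (basis k) sA sP PP PA; exists V.
move=> /choice[F HF].
pose P := fix P k : bop :=
  if k is j.+1 then P j + F (P j, j) * adj (F (P j, j)) else 0.
pose V k := F (P k, k).
have PS k : P k.+1 = P k + V k * adj (V k) by [].
have gP k : good (P k).
  elim: k => [|k IH]; last by rewrite PS; case: (HF (P k, k) IH).
  by split; rewrite /= ?adj0 ?mulr0 ?mul0r.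
have H k := HF (P k, k) (gP k); rewrite /= -/(V _) in H.
have PVlt k l : (k < l)%N -> P l * V k = V k.
  elim: l => // l IH; rewrite ltnS leq_eqVlt => /orP[/eqP->|kl].
    have [oV PV _ _ _] := H l.
    by rewrite PS mulrDl PV add0r onb_proj.
  rewrite PS mulrDl IH// -[in X in _ + X](IH kl) mulrA -(mulrA (V l)).
  have [sP _ _] := gP l; have [_ PV _ _ _] := H l.
  by rewrite -sP -adjM PV adj0 mulr0 mul0r addr0.
have VP l : adj (V l) * P l = 0.
  by have [sP _ _] := gP l; have [_ PV _ _ _] := H l; rewrite -sP -adjM PV adj0.
have ort k l : (k < l)%N -> adj (V l) * V k = 0 /\ adj (V l) * A * V k = 0.
  move=> kl; rewrite -(PVlt k l kl) !mulrA VP mul0r; split=> //.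
  by have [_ _ PA] := gP l; rewrite -(mulrA _ A) -PA mulrA VP !mul0r.
exists V; split.
- by move=> k; case: (H k).
- move=> k l /eqP; rewrite neq_ltn => /orP[|/ort[e1 e2]]; first exact: ort.
  split; first by rewrite -(adjK (V k)) -adjM e1 adj0.
  by rewrite -(adjK (V k)) -{1}sA -!adjM mulrA e2 adj0.
- by move=> k; case: (H k).
- move=> k; have -> : \sum_(l < k.+1) V l * adj (V l) = P k.+1.
    elim: k.+1 => [|j IH]; first by rewrite big_ord0.
    by rewrite big_ord_recr IH.
  by case: (H k).
Qed.

End orthonormal.

(** * Factoring bounded operators through diagonal ones *)

Section diagonalization.
Variable R : realType.
Local Notation C := R[i].
Local Notation ell2 := (ell2 R).
Local Notation bop := (bop R).
Local Notation basis := (basis R).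
Implicit Types (x y z : ell2) (A P T V W : bop) (u v : nat -> ell2).

Lemma l2norm_basis n : l2norm (basis n) = 1.
Proof.
have := dot_normE (basis n); rewrite dot_basis basisE eqxx => -[] /esym/eqP.
by rewrite sqrp_eq1 ?l2norm_ge0// => /eqP.
Qed.

Lemma l2norm_dot_nrm x :
  (l2norm x)%:C%C * dot (nrm x) (nrm x) = (l2norm x)%:C%C.
Proof.
have [->|x0] := eqVneq (l2norm x) 0; first by rewrite mul0r.
rewrite /nrm dotZl dotZr conjc_real dot_normE -!rmorphM /=.
by congr (_%:C)%C; field.
Qed.

Lemma norm_columns_bounded T :
  (fun n => (l2norm (T (basis n)))%:C%C) \in @bounded_seq R.
Proof.
have [M _ TM] := bop_bound T; apply/bounded_seqP; exists M => n.
rewrite /= expr0n addr0 sqrtr_sqr ger0_norm ?l2norm_ge0//.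
by have := TM (basis n); rewrite l2norm_basis mulr1.
Qed.

(** A polar decomposition: [a] holds the column norms and [Q] the normalised columns. The second
    identity puts [diag_op a] into every ideal containing [T]. *)
Lemma orthogonal_columns T :
  (forall m n, m <> n -> dot (T (basis m)) (T (basis n)) = 0) ->
  exists (a : linf R) Q, T = Q * diag_op a /\ diag_op a = adj Q * T.
Proof.
move=> oT; pose q n := nrm (T (basis n)).
have oq : orthonormal0 q.
  split=> [m n mn|n]; last exact: nrm_idem.
  by rewrite /q /nrm dotZl dotZr oT ?mulr0.
have [Q QE] := synthesis oq.
pose a := Linf (norm_columns_bounded T).
have TE : T = Q * diag_op a.
  apply: bop_basis_eq => n; rewrite bopME diag_op_basis bopZ QE.
  by rewrite -[a n]/((l2norm (T (basis n)))%:C)%C l2norm_nrm.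
exists a, Q; split=> //; rewrite TE mulrA; apply: bop_basis_eq => n.
rewrite !bopME diag_op_basis !bopZ onb_adj.
  rewrite QE scalerA; congr (_ *: _); exact/esym/l2norm_dot_nrm.
by case: oq => oq1 oq2; split=> [i j ij|i]; rewrite !QE//; exact: oq1.
Qed.

(* The Lanczos systems are split by the parity of their indices: within one  *)
(* parity class A = T^* T is diagonal, so that T has orthogonal columns.      *)
Lemma diagonalization T : exists (a : bool -> linf R) (Q W : bool -> bop),
  T = \sum_p Q p * diag_op (a p) * adj (W p) /\
  forall p, diag_op (a p) = adj (Q p) * T * W p.
Proof.
pose A := adj T * T.
have sA : adj A = A by rewrite /A adjM adjK.
have [V [oV cross tri tot]] := reducing_sequence sA.
have VV0 k l x y : k <> l -> dot (V k x) (V l y) = 0.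
  by move=> /cross[e _]; rewrite dot_adjl -bopME e dot0l.
have VAV0 k l x y : k <> l -> dot (A (V k x)) (V l y) = 0.
  by move=> /cross[_ e]; rewrite dot_adjl -[adj _ _]/((adj (V l) * A * V k) x) e dot0l.
have VA0 k i j : i <> j -> odd i = odd j ->
    dot (A (V k (basis i))) (V k (basis j)) = 0.
  move=> /eqP; rewrite neq_ltn => /orP[] lt par.
    apply: tri; rewrite ltn_neqAle lt andbT; apply/eqP => e.
    by move: par; rewrite -e /=; case: odd.
  rewrite -{1}sA -dot_adjl dotC tri ?conjc0// ltn_neqAle lt andbT.
  by apply/eqP => e; move: par; rewrite -e /=; case: odd.
(* The vectors of parity [p] from all rounds [k] form one system, indexed through the coding of
   pairs and padded by zeros. *)
pose w p n : ell2 := if @pickle_inv (nat * nat)%type n is Some (k, i) then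
  (if odd i == p then V k (basis i) else 0) else 0.
have wP p n : w p n = 0 \/ exists k i,
    [/\ n = pickle (k, i), odd i = p & w p n = V k (basis i)].
  rewrite /w; case e: pickle_inv => [[k i]|]; last by left.
  case: eqP => par; last by left.
  right; exists k, i; split=> //.
  by have := @pickle_invK (nat * nat)%type n; rewrite e.
have wE k i : w (odd i) (pickle (k, i)) = V k (basis i).
  by rewrite /w pickleK_inv eqxx.
have ow p q m n : (p, m) <> (q, n) -> dot (w p m) (w q n) = 0.
  case: (wP p m) => [->|[k [i [-> pi ->]]]]; first by rewrite dot0l.
  case: (wP q n) => [->|[l [j [-> qj ->]]]]; first by rewrite dot0r.
  move=> ne; have [kl|/eqP kl] := eqVneq k l; last exact: VV0.
  rewrite -kl; case: (oV k) => ok _; apply: ok => ij; apply: ne.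
  by rewrite -pi -qj kl ij.
have idw p n : dot (w p n) (w p n) *: w p n = w p n.
  case: (wP p n) => [->|[k [i [_ _ ->]]]]; first by rewrite scaler0.
  by case: (oV k) => _ ->.
have onw p : orthonormal0 (w p).
  by split=> // m n mn; apply: ow => -[].
have oAw p m n : m <> n -> dot (A (w p m)) (w p n) = 0.
  case: (wP p m) => [->|[k [i [-> pi ->]]]]; first by rewrite bop_at0 dot0l.
  case: (wP p n) => [->|[l [j [-> qj ->]]]]; first by rewrite dot0r.
  move=> ne; have [kl|/eqP kl] := eqVneq k l; last exact: VAV0.
  rewrite -kl; apply: VA0; last by rewrite pi qj.
  by move=> ij; apply: ne; rewrite kl ij.
have /choice[W WE] p := synthesis (onw p).
have oW p : onb (W p).
  by case: (onw p) => o1 o2; split=> [m n mn|n]; rewrite !WE//; exact: o1.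
pose E := \sum_p W p * adj (W p).
have EW p n : E (w p n) = w p n.
  have Wp : (W p * adj (W p)) (w p n) = w p n.
    by rewrite -WE -[LHS]/((W p * adj (W p) * W p) (basis n)) onb_proj.
  have Wq q : q <> p -> (W q * adj (W q)) (w p n) = 0.
    move=> qp; rewrite bopME (_ : adj (W q) (w p n) = 0) ?bop_at0//.
    by apply: ell2_ext => m; rewrite adjE WE ow// => -[pq _]; exact: qp.
  rewrite /E big_bool bopDE; case: p Wp Wq => -> Wq.
    by rewrite Wq// addr0.
  by rewrite Wq// add0r.
have EV k : E * V k = V k.
  by apply: bop_basis_eq => i; rewrite bopME -wE EW.
(* By [tot], each [basis k] is a sum of vectors in the ranges of [V 0], ..., [V k], all of which [E]
   fixes. *)
have E1 : E = 1.
  apply: bop_basis_eq => k; rewrite -{1}(tot k) -bopME mulr_sumr.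
  rewrite (eq_bigr (fun l : 'I_k.+1 => V l * adj (V l))) ?tot// => l _.
  by rewrite mulrA EV.
have oTW p m n : m <> n -> dot ((T * W p) (basis m)) ((T * W p) (basis n)) = 0.
  by move=> mn; rewrite !bopME !WE dot_adjl -bopME oAw.
have /choice[a /choice[Q aQ]] p := orthogonal_columns (oTW p).
exists a, Q, W; split=> [|p]; last by rewrite -mulrA; case: (aQ p).
rewrite -[LHS]mulr1 -E1 mulr_sumr; apply: eq_bigr => p _.
by rewrite mulrA; case: (aQ p) => <-.
Qed.

End diagonalization.

(** * Partial injections and the algebra Gamma *)

Section linear_span.
Variables (K : pzRingType) (V : lmodType K).
Implicit Types (X Y : set V) (P : set V).

Lemma lin_span_sub X : X `<=` lin_span X.
Proof.
move=> x Xx; exists 1%N, (fun=> 1), (fun=> x).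
by split=> //; rewrite big_ord1 scale1r.
Qed.

Lemma lin_span0 X : lin_span X 0.
Proof. by exists 0%N, (fun=> 0), (fun=> 0); split=> [[]//|]; rewrite big_ord0. Qed.

Lemma lin_span_lin X a x y : lin_span X x -> lin_span X y ->
  lin_span X (a *: x + y).
Proof.
move=> [n [c [u [Xu ->]]]] [m [d [v [Xv ->]]]].
pose join T (f : 'I_n -> T) (g : 'I_m -> T) (i : 'I_(n + m)) :=
  match fintype.split i with inl j => f j | inr j => g j end.
exists (n + m)%N, (join _ (fun i => a * c i) d), (join _ u v); split.
  by move=> i; rewrite /join; case: fintype.split.
have splitl (j : 'I_n) : fintype.split (lshift m j) = inl j := unsplitK (inl j).
have splitr (j : 'I_m) : fintype.split (rshift n j) = inr j := unsplitK (inr j).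
rewrite big_split_ord scaler_sumr /join /=; congr (_ + _); apply: eq_bigr => i _.
  by rewrite splitl scalerA.
by rewrite splitr.
Qed.

Lemma lin_spanD X x y : lin_span X x -> lin_span X y -> lin_span X (x + y).
Proof. by rewrite -{2}[x]scale1r; exact: lin_span_lin. Qed.

Lemma lin_spanB X x y : lin_span X x -> lin_span X y -> lin_span X (x - y).
Proof. by move=> Xx Xy; rewrite addrC -scaleN1r; exact: lin_span_lin. Qed.

Lemma lin_span_ind X P : P 0 -> (forall a x y, X x -> lin_span X y -> P y -> P (a *: x + y)) ->
  forall x, lin_span X x -> P x.
Proof.
move=> P0 PX _ [n [c [x [Xx ->]]]].
elim: n c x Xx => [|n IH] c x Xx; first by rewrite big_ord0.
rewrite big_ord_recl; apply: PX => //; last exact: IH.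
by exists n, (fun i => c (lift ord0 i)), (fun i => x (lift ord0 i)).
Qed.

Lemma lin_span_sum X I (s : seq I) (F : I -> V) :
  (forall i, lin_span X (F i)) -> lin_span X (\sum_(i <- s) F i).
Proof.
move=> XF; elim: s => [|i s IH]; first by rewrite big_nil; exact: lin_span0.
by rewrite big_cons; exact: lin_spanD.
Qed.

End linear_span.

(** * Partial injections and colourings of graphs of bounded degree *)

Section partial_injections.
Implicit Types (f g : Emb) (fs : seq Emb) (r : nat -> nat -> Prop).

Lemma emb_invP f n m : emb_inv f n = Some m <-> f m = Some n.
Proof. exact: emb_inv_funE. Qed.

Lemma emb_compP f g m n k : obind f (g m) = Some k -> obind f (g n) = Some k -> m = n.
Proof.
case gm: (g m) => [i|]//=; case gn: (g n) => [j|]//= fi fj.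
by apply: emb_inj gm _; rewrite gn (emb_inj fj fi).
Qed.

Definition emb_comp f g : Emb := MkEmb (@emb_compP f g).

Lemma emb_some_inj (h : nat -> nat) : injective h ->
  forall m n k, Some (h m) = Some k -> Some (h n) = Some k -> m = n.
Proof. by move=> ih m n k [<-] [] /ih. Qed.

Definition emb_total (h : nat -> nat) (ih : injective h) : Emb :=
  MkEmb (emb_some_inj ih).

Definition emb_id : Emb := emb_total (@inj_id nat).

Lemma emb_of_rel r :
  (forall n m m', r n m -> r n m' -> m = m') ->
  (forall n n' m, r n m -> r n' m -> n = n') ->
  exists f, forall n m, f n = Some m <-> r n m.
Proof.
move=> rf ri.
pose f n := if pselect (exists m, r n m) is left ex then Some (projT1 (cid ex))
  else None.
have fE n m : f n = Some m <-> r n m.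
  rewrite /f; case: pselect => [ex|nex]; last by split=> // rnm; case: nex; exists m.
  by case: cid => k /= rk; split=> [[<-]//|/(rf _ _ _ rk)->].
have fi m n k : f m = Some k -> f n = Some k -> m = n.
  by move=> /fE rm /fE; exact: ri rm.
by exists (MkEmb fi).
Qed.

(** A directed graph in which at most [size fs] edges leave, and at most [size fs] enter, each
    vertex. *)
Definition linked fs n m := has (fun f : Emb => f n == Some m) fs.

Lemma has_allpairs A B D (F : A -> B -> D) (p : pred A) (q : pred B) (w : pred D)
    (s : seq A) (t : seq B) : has p s -> has q t ->
  (forall a b, p a -> q b -> w (F a b)) -> has w [seq F a b | a <- s, b <- t].
Proof.
move=> ps qt pq; elim: s ps => //= a s IH; rewrite has_cat has_map.
case/orP => [pa|/IH->]; last exact: orbT.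
by rewrite (sub_has _ qt)// => b; exact: pq.
Qed.

Definition fresh (s : seq nat) := find (fun k => k \notin s) (iota 0 (size s).+1).

(** Pigeonhole: the [(size s).+1] candidates cannot all occur in [s]. *)
Lemma freshP s : fresh s \notin s /\ (fresh s <= size s)%N.
Proof.
have hs : has (fun k => k \notin s) (iota 0 (size s).+1).
  apply/negPn/negP => /hasPn all_s.
  suff : (size (iota 0 (size s).+1) <= size s)%N by rewrite size_iota ltnn.
  by apply: uniq_leq_size (iota_uniq _ _) _ => k /all_s; rewrite negbK.
have lt : (fresh s < (size s).+1)%N by rewrite -[X in (_ < X)%N](size_iota 0) -has_find.
by split=> //; have := nth_find 0%N hs; rewrite nth_iota ?add0n.
Qed.

(* Greedy colouring of a graph of bounded degree. *)
Lemma emb_coloring fs : exists K (c : nat -> nat), (forall n, (c n < K)%N) /\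
  forall n m, linked fs n m -> n <> m -> c n <> c m.
Proof.
pose nb n := pmap id [seq f n | f : Emb <- fs] ++
  pmap id [seq emb_inv f n | f : Emb <- fs].
have szp (F : Emb -> option nat) : (size (pmap id (map F fs)) <= size fs)%N.
  by rewrite size_pmap -[leqRHS](size_map F) count_size.
have nbs n : (size (nb n) <= size fs + size fs)%N.
  by rewrite size_cat leq_add.
have memp (F : Emb -> option nat) m :
    (m \in pmap id (map F fs)) = has (fun f => F f == Some m) fs.
  by rewrite mem_pmap map_id -has_pred1 has_map.
have nb1 n m : linked fs n m -> m \in nb n.
  by move=> fnm; rewrite mem_cat !memp [has _ _]fnm.
have nb2 n m : linked fs n m -> n \in nb m.
  move=> fnm; rewrite mem_cat !memp orbC.
  rewrite (eq_has (a2 := fun f : Emb => f n == Some m)) ?[has _ _]fnm// => f /=.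
  by apply/eqP/eqP => /emb_invP.
(* [s] lists the colours given so far; the next vertex avoids those of its smaller neighbours in
   either direction. *)
pose step s := rcons s (fresh [seq nth 0%N s m | m <- nb (size s) & (m < size s)%N]).
pose S n := iter n step [::].
pose c n := fresh [seq nth 0%N (S n) m | m <- nb n & (m < n)%N].
have SE n : S n = mkseq c n.
  elim: n => // n IH; have sz : size (S n) = n by rewrite IH size_mkseq.
  by rewrite /S iterS -/(S n) mkseqS -IH /step sz.
have cE n m : m \in nb n -> (m < n)%N -> c n <> c m.
  move=> mn lt ce; have [+ _] := freshP [seq nth 0%N (S n) m | m <- nb n & (m < n)%N].
  rewrite -/(c n) ce => /negP; apply; apply/mapP; exists m.
    by rewrite mem_filter lt.
  by rewrite SE nth_mkseq.
exists (size fs + size fs).+1, c; split=> [n|n m fnm /eqP].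
  rewrite ltnS; have [_ le] := freshP [seq nth 0%N (S n) m | m <- nb n & (m < n)%N].
  apply: leq_trans le _; rewrite size_map; apply: leq_trans (nbs n).
  by rewrite size_filter count_size.
rewrite neq_ltn => /orP[nm|mn]; last exact: cE (nb1 _ _ fnm) mn.
by move=> e; apply: (cE _ _ (nb2 _ _ fnm) nm); rewrite e.
Qed.

End partial_injections.

(** * Matrices of operators in the algebra, and part (i) *)

Section Gamma_algebra.
Variable R : realType.
Local Notation C := R[i].
Local Notation ell2 := (ell2 R).
Local Notation bop := (bop R).
Local Notation basis := (basis R).
Local Notation linf := (linf R).
Local Notation diag := (@diag_op R).
Local Notation U := (emb_op R).
Local Notation Gamma := (Gamma R).
Implicit Types (f g : Emb) (a b : linf) (T : bop) (S : set linf) (I : set bop).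

Lemma linf_ext a b : (forall n, a n = b n) -> a = b.
Proof. by move=> ab; apply/val_inj/funext. Qed.

Lemma linfME a b n : (a * b) n = a n * b n. Proof. by []. Qed.
Lemma linfDE a b n : (a + b) n = a n + b n. Proof. by []. Qed.

Lemma cst_bounded (c : C) : (fun=> c) \in @bounded_seq R.
Proof. by apply/bounded_seqP; exists (normc c). Qed.
Definition linf_cst c : linf := Linf (cst_bounded c).

Lemma push_some (f : Emb) (x : nat -> C) n m : f n = Some m -> push f x m = x n.
Proof. by move=> /(emb_invP f m n) fm; rewrite /push fm. Qed.

Lemma push_none (f : Emb) (x : nat -> C) m :
  (forall n, f n <> Some m) -> push f x m = 0.
Proof.
move=> fm; rewrite /push; case e: (emb_inv f m) => [n|//].
by case: (fm n); apply/emb_invP.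
Qed.

Lemma emb_op_comp f g : U f * U g = U (emb_comp f g).
Proof.
apply: bop_basis_eq => n; rewrite bopME !emb_op_basis.
rewrite -[emb_comp f g n]/(obind f (g n)); case: (g n) => [m|]; last by rewrite bop_at0.
by rewrite emb_op_basis.
Qed.

Lemma emb_op_id : U emb_id = 1.
Proof. by apply: bop_basis_eq => n; rewrite emb_op_basis. Qed.

Lemma emb_op_inv_basis f n m : f n = Some m -> U (emb_inv f) (basis m) = basis n.
Proof. by move=> /(emb_invP f m n) fm; rewrite emb_op_basis fm. Qed.

Lemma emb_op_diag f a : U f * diag a = diag (linf_push f a) * U f.
Proof.
apply: bop_basis_eq => n; rewrite !bopME diag_op_basis bopZ emb_op_basis.
case fn: (f n) => [m|]; last by rewrite bop_at0 scaler0.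
by rewrite diag_op_basis /= (push_some _ fn).
Qed.

Lemma diag_opM a b : diag (a * b) = diag a * diag b.
Proof.
by apply: bop_basis_eq => n; rewrite bopME !diag_op_basis bopZ diag_op_basis scalerA mulrC.
Qed.

Lemma diag_op_lin (c : C) a b :
  diag (linf_cst c * a + b) = c *: diag a + diag b.
Proof.
apply: bop_basis_eq => n.
by rewrite bopDE bopZE !diag_op_basis scalerA -scalerDl.
Qed.

Lemma diag_op0 : diag 0 = 0.
Proof. by apply: bop_basis_eq => n; rewrite diag_op_basis scale0r. Qed.

Lemma diag_op1 : diag 1 = 1.
Proof. by apply: bop_basis_eq => n; rewrite diag_op_basis scale1r. Qed.

Lemma diag_opB a b : diag (a - b) = diag a - diag b.
Proof.
by apply: bop_basis_eq => n; rewrite bopBE !diag_op_basis -scalerBl.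
Qed.

Lemma diag_op_sum J (s : seq J) (F : J -> linf) :
  diag (\sum_(j <- s) F j) = \sum_(j <- s) diag (F j).
Proof.
elim: s => [|j s IH]; rewrite ?big_nil ?diag_op0// !big_cons -IH.
by rewrite -[diag (F j)]scale1r -diag_op_lin (_ : linf_cst 1 = 1) ?mul1r//; exact: linf_ext.
Qed.

(** The action of [f] on sequences is a two-sided multiplication inside [Gamma], which makes
    [S_of I] symmetric. *)
Lemma diag_op_push f a : diag (linf_push f a) = U f * diag a * U (emb_inv f).
Proof.
rewrite emb_op_diag -mulrA; apply: bop_basis_eq => m; rewrite !bopME !diag_op_basis.
have [[n fn]|nf] := pselect (exists n, f n = Some m).
  by rewrite (emb_op_inv_basis fn) emb_op_basis fn diag_op_basis.
rewrite [linf_push f a m]push_none ?scale0r; last by move=> n fn; apply: nf; exists n.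
rewrite emb_op_basis; case e: (emb_inv f m) => [n|]; last by rewrite !bop_at0.
by case: nf; exists n; apply/emb_invP.
Qed.

Lemma bop_scaleAl (c : C) (T T' : bop) : (c *: T) * T' = c *: (T * T').
Proof. by apply: bop_eqP => x; rewrite bopME !bopZE. Qed.

Lemma bop_scaleAr (c : C) (T T' : bop) : T * (c *: T') = c *: (T * T').
Proof. by apply: bop_eqP => x; rewrite bopME !bopZE bopZ. Qed.

Lemma Gamma_diag a : Gamma (diag a).
Proof. by apply: lin_span_sub; exists a, emb_id; rewrite emb_op_id mulr1. Qed.

Lemma Gamma_emb f : Gamma (U f).
Proof. by apply: lin_span_sub; exists 1, f; rewrite diag_op1 mul1r. Qed.

Lemma lin_span_mul (X Y Z : set bop) :
  (forall x y, X x -> Y y -> lin_span Z (x * y)) ->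
  forall x y, lin_span X x -> lin_span Y y -> lin_span Z (x * y).
Proof.
move=> XYZ + y + Yy; apply: lin_span_ind => [|c x x' Xx _ IHx].
  by rewrite mul0r; exact: lin_span0.
rewrite mulrDl bop_scaleAl; apply: lin_span_lin => //.
move: y Yy {IHx}; apply: lin_span_ind => [|d y y' Yy _ IHy].
  by rewrite mulr0; exact: lin_span0.
by rewrite mulrDr bop_scaleAr; apply: lin_span_lin => //; exact: XYZ.
Qed.

Lemma Gamma_mul T T' : Gamma T -> Gamma T' -> Gamma (T * T').
Proof.
apply: lin_span_mul => _ _ [a [f ->]] [b [g ->]]; apply: lin_span_sub.
exists (a * linf_push f b), (emb_comp f g).
by rewrite diag_opM -emb_op_comp !mulrA -(mulrA _ (U f)) emb_op_diag !mulrA.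
Qed.

Lemma ideal_setI_Gamma (J : set bop) : is_ideal setT J -> is_ideal Gamma (J `&` Gamma).
Proof.
move=> [_ J0 JB JM]; split.
- by move=> T [].
- by split=> //; exact: lin_span0.
- by move=> x y [Jx Gx] [Jy Gy]; split; [exact: JB|exact: lin_spanB].
- by move=> a x Ga [Jx Gx]; have [] := JM a x Logic.I Jx; split; split=> //; exact: Gamma_mul.
Qed.

Lemma ideal_add (A : pzRingType) (D I : set A) x y :
  is_ideal D I -> I x -> I y -> I (x + y).
Proof.
by move=> [_ I0 IB _] Ix Iy; rewrite -[y]opprK -(sub0r y); apply: (IB) => //; exact: IB.
Qed.

Lemma ideal_sum (A : pzRingType) (D I : set A) J (s : seq J) (F : J -> A) :
  is_ideal D I -> (forall j, I (F j)) -> I (\sum_(j <- s) F j).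
Proof.
move=> iI IF; elim: s => [|j s IH]; first by rewrite big_nil; case: iI.
by rewrite big_cons; exact: ideal_add iI _ _ .
Qed.

Lemma S_of_symmetric I : is_ideal Gamma I -> symmetric_ideals R (S_of I).
Proof.
move=> [IG I0 IB IM]; split.
  split=> //; rewrite /S_of /=.
  - by rewrite diag_op0.
  - by move=> a b; rewrite diag_opB; exact: IB.
  - move=> a b _ Ib; rewrite !diag_opM.
    by have [] := IM _ _ (Gamma_diag a) Ib.
move=> f _ [a Ia <-]; rewrite /S_of /= diag_op_push.
have [Ua _] := IM _ _ (Gamma_emb f) Ia.
by have [_] := IM _ _ (Gamma_emb (emb_inv f)) Ua.
Qed.

Lemma I_of_ideal S : symmetric_ideals R S -> is_ideal Gamma (I_of S).
Proof.
move=> [[_ S0 SB SM] Ssym].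
split.
- apply: lin_span_ind => [|c x y [a [f [_ ->]]] _]; first exact: lin_span0.
  by apply: lin_span_lin; apply: lin_span_sub; exists a, f.
- exact: lin_span0.
- by move=> x y; exact: lin_spanB.
move=> T x GT Ix; split; last first.
  apply: lin_span_mul Ix GT => _ _ [a [f [Sa ->]]] [b [g ->]].
  apply: lin_span_sub; exists (a * linf_push f b), (emb_comp f g); split.
    by case: (SM (linf_push f b) a).
  by rewrite diag_opM -emb_op_comp !mulrA -(mulrA _ (U f)) emb_op_diag !mulrA.
apply: lin_span_mul GT Ix => _ _ [b [g ->]] [a [f [Sa ->]]].
apply: lin_span_sub; exists (b * linf_push g a), (emb_comp g f); split.
  by case: (SM b (linf_push g a)) => //; apply: Ssym; exists a.
by rewrite diag_opM -emb_op_comp !mulrA -(mulrA _ (U g)) emb_op_diag !mulrA.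
Qed.

(* The diagonal of diag a * U_f is a restricted to the fixed points of f.    *)
Lemma S_of_I_of S : symmetric_ideals R S -> S_of (I_of S) = S.
Proof.
move=> [iS Ssym]; apply/seteqP; split=> [a|a Sa]; last first.
  by apply: lin_span_sub; exists a, emb_id; rewrite emb_op_id mulr1.
suff diagS T : I_of S T -> exists2 b, S b & forall n, T (basis n) n = b n.
  move=> /diagS[b Sb ab]; suff -> : a = b by [].
  by apply: linf_ext => n; rewrite -ab /= eqxx mulr1.
move: T; apply: lin_span_ind => [|c _ T [b [f [Sb ->]]] _ [b' Sb' Tb']].
  by exists 0 => //; case: iS.
have fixb : (fun n => (f n == Some n)%:R) \in @bounded_seq R.
  apply/bounded_seqP; exists 1 => n.
  by case: (_ == _); rewrite ?normc1 ?normc0.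
exists (linf_cst c * Linf fixb * b + b').
  by apply: (ideal_add iS _ Sb'); case: iS => _ _ _ /(_ (linf_cst c * Linf fixb) b Logic.I Sb)[].
move=> n; rewrite bopDE bopZE linfDE !linfME -Tb' bopME emb_op_basis.
rewrite -[LHS]/(c * (diag b _ n) + T (basis n) n); congr (_ + _).
rewrite -mulrA; congr (_ * _); rewrite /=; case fn: (f n) => [m|] /=.
  by rewrite mulrC eq_sym.
by rewrite mulr0 mul0r.
Qed.

Lemma bop_ext_basis (T T' : bop) :
  (forall n m, T (basis n) m = T' (basis n) m) -> T = T'.
Proof. by move=> TT; apply: bop_basis_eq => n; apply: ell2_ext => m; exact: TT. Qed.

(** The support of the matrix is covered by the graphs of the finitely many [f] in a combination
    representing [T]. *)
Lemma Gamma_linked T : Gamma T ->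
  exists fs, forall n m, T (basis n) m <> 0 -> linked fs n m.
Proof.
move: T; apply: lin_span_ind => [|c _ T [a [f ->]] _ [fs Tfs]]; first by exists [::].
exists (f :: fs) => n m; rewrite bopDE bopZE bopME emb_op_basis.
rewrite -[ell2_val _ _]/(c * (diag a _ m) + T (basis n) m) /linked /=.
have [->|Tn] := pselect (T (basis n) m = 0); last by rewrite [has _ _]Tfs// orbT.
rewrite addr0; case: eqP => //= fn; case e: (f n) => [k|]; last by rewrite /= !mulr0.
rewrite /=; case: eqP => [mk|_]; last by rewrite !mulr0.
by case: fn; rewrite e mk.
Qed.

Definition indic (P : pred nat) : nat -> C := fun n => (P n)%:R.
Lemma indic_bounded P : indic P \in @bounded_seq R.
Proof.
apply/bounded_seqP; exists 1 => n; rewrite /indic.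
by case: (P n); rewrite ?normc1 ?normc0.
Qed.
Definition proj P : bop := diag (Linf (indic_bounded P)).

Lemma proj_sum (c : nat -> nat) K : (forall n, (c n < K)%N) ->
  \sum_(k < K) proj (fun n => c n == k) = 1.
Proof.
move=> cK; rewrite -diag_op_sum -diag_op1; congr diag; apply: linf_ext => n.
transitivity (\sum_(k < K) ((c n == k)%:R : C)).
  by elim/big_ind2: _ => // x u y v <- <-.
by rewrite (bigD1 (Ordinal (cK n)))//= eqxx big1 ?addr0// => k; rewrite -val_eqE /= eq_sym => /negPf->.
Qed.

Lemma proj_entry P Q T n m :
  (proj P * T * proj Q) (basis n) m = (P m)%:R * (Q n)%:R * T (basis n) m.
Proof.
rewrite !bopME /proj diag_op_basis bopZ bopZ.
rewrite -[LHS]/((Q n)%:R * ((P m)%:R * T (basis n) m)); ring.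
Qed.

(** [T] has at most one nonzero entry in each row and column, and [a] lists them by row. The second
    identity keeps [diag a] in any ideal containing [T]. *)
Lemma partial_permutation T (r : nat -> nat -> Prop) :
  (forall n m m', r n m -> r n m' -> m = m') ->
  (forall n n' m, r n m -> r n' m -> n = n') ->
  (forall n m, T (basis n) m <> 0 -> r n m) ->
  exists a g, T = diag a * U g /\ diag a = T * U (emb_inv g).
Proof.
move=> rf ri Tr; have [g gE] := emb_of_rel rf ri.
have [M M0 TM] := bop_bound T.
pose z m : C := if emb_inv g m is Some n then T (basis n) m else 0.
have bz : z \in @bounded_seq R.
  apply/bounded_seqP; exists M => m; rewrite /z.
  case: (emb_inv g m) => [n|]; last by rewrite normc0 ltW.
  apply: le_trans (normc_le_l2norm _ _) _.
  by have := TM (basis n); rewrite l2norm_basis mulr1.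
have zE n m : g n = Some m -> z m = T (basis n) m.
  by move=> /(emb_invP g m n) gm; rewrite /z gm.
have TE : T = diag (Linf bz) * U g.
  apply: bop_ext_basis => n m; rewrite bopME emb_op_basis.
  case gn: (g n) => [k|].
    rewrite diag_op_basis -[RHS]/(z k * (m == k)%:R) (zE _ _ gn).
    case: eqP => [->|mk]; first by rewrite mulr1.
    rewrite mulr0; apply: contrapT => /Tr /gE; rewrite gn => -[] /esym.
    exact: mk.
  by rewrite bop_at0; apply: contrapT => /Tr /gE; rewrite gn.
exists (Linf bz), g; split=> //; rewrite [in RHS]TE.
apply: bop_basis_eq => m; rewrite !bopME diag_op_basis.
rewrite -[Linf bz m]/(z m) {1}/z emb_op_basis.
case e: (emb_inv g m) => [n|]; last by rewrite !bop_at0 scale0r.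
have gn := (emb_invP g m n).1 e.
by rewrite emb_op_basis gn diag_op_basis -(zE _ _ gn).
Qed.

(* Colour rows and columns so that two entries of the support of T lying in  *)
(* one row (column) have columns (rows) of different colours: each colour    *)
(* block of T is then of the form diag a * U_g.                              *)
Lemma I_of_S_of I : is_ideal Gamma I -> I_of (S_of I) = I.
Proof.
move=> [IG I0 IB IM]; apply/seteqP; split=> [T|T IT].
  have iI : is_ideal Gamma I by [].
  move: T; apply: lin_span_ind => // c _ T [a [f [Ia ->]]] _ IT.
  apply: ideal_add iI _ IT.
  have [_ H] := IM _ _ (Gamma_emb f) Ia.
  have [+ _] := IM _ _ (Gamma_diag (linf_cst c)) H.
  suff -> : diag (linf_cst c) * (diag a * U f) = c *: (diag a * U f) by [].
  rewrite mulrA -bop_scaleAl; congr (_ * _).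
  by have := diag_op_lin c a 0; rewrite diag_op0 !addr0 diag_opM.
have [fs Tfs] := Gamma_linked (IG _ IT).
(* Two columns meeting the support in a common row are linked by some [emb_comp (emb_inv f) g], so
   [c] separates them; [d] separates rows in the same way. *)
have [K [c [cK cP]]] := emb_coloring [seq emb_comp (emb_inv f) g | f <- fs, g <- fs].
have [L [d [dL dP]]] := emb_coloring [seq emb_comp f (emb_inv g) | f <- fs, g <- fs].
pose X (k l : nat) := proj (fun m => d m == l) * T * proj (fun n => c n == k).
have -> : T = \sum_(k < K) \sum_(l < L) X k l.
  rewrite -[LHS]mulr1 -(proj_sum cK) mulr_sumr; apply: eq_bigr => k _.
  by rewrite -[in LHS](mul1r T) -(proj_sum dL) !mulr_suml.
apply: lin_span_sum => k; apply: lin_span_sum => l.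
pose r n m := [/\ c n = k, d m = l & linked fs n m].
have IX : I (X k l).
  have [H _] := IM _ _ (Gamma_diag (Linf (indic_bounded (fun m => d m == l)))) IT.
  by have [_ ] := IM _ _ (Gamma_diag (Linf (indic_bounded (fun n => c n == k)))) H.
have [||n m|a [g [XE aE]]] := @partial_permutation (X k l) r.
- move=> n m m' [_ dm fnm] [_ dm' fnm']; apply: contrapT => mm'.
  have := dP m m' _ mm'; rewrite dm dm'; apply=> //.
  apply: has_allpairs fnm' fnm _ => f g /eqP fn /eqP gn.
  by apply/eqP; rewrite -[LHS]/(obind f (emb_inv g m)) ((emb_invP g m n).2 gn).
- move=> n n' m [cn _ fnm] [cn' _ fnm']; apply: contrapT => nn'.
  have := cP n n' _ nn'; rewrite cn cn'; apply=> //.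
  apply: has_allpairs fnm' fnm _ => f g /eqP fn /eqP gn.
  apply/eqP; rewrite -[LHS]/(obind (emb_inv f) (g n)) gn.
  exact/emb_invP.
- rewrite proj_entry /r; have [dm|] := eqVneq (d m) (l : nat); last by rewrite !mul0r.
  have [cn|] := eqVneq (c n) (k : nat); last by rewrite mulr0 mul0r.
  by rewrite !mul1r => /Tfs.
apply: lin_span_sub; exists a, g; split=> //.
by rewrite /S_of /= aE; have [_] := IM _ _ (Gamma_emb (emb_inv g)) IX.
Qed.

End Gamma_algebra.

(** * Diagonal operators in J_S *)

Section domination.
Variable R : realType.
Local Notation C := R[i].
Local Notation ell2 := (ell2 R).
Local Notation bop := (bop R).
Local Notation basis := (basis R).
Local Notation linf := (linf R).
Local Notation diag := (@diag_op R).
Local Notation U := (emb_op R).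
Implicit Types (f g : Emb) (a b : linf) (T B : bop) (S : set linf) (x y z : ell2).

Lemma l2norm_le (K : R) y z : 0 <= K ->
  (forall n, normc (y n) <= K * normc (z n)) -> l2norm y <= K * l2norm z.
Proof.
move=> K0 yz; apply: l2norm_bound => [|N]; first by rewrite mulr_ge0 ?l2norm_ge0.
rewrite exprMn; apply: le_trans (ler_wpM2l (sqr_ge0 K) (sum_sqnormc_le z N)).
rewrite /series /= mulr_sumr; apply: ler_sum => n _; rewrite /sqnormc -exprMn.
by rewrite ler_sqr ?nnegrE ?normc_ge0// mulr_ge0 ?normc_ge0.
Qed.

Lemma l2norm_emb_op f x : l2norm (U f x) <= l2norm x.
Proof. by apply: l2norm_bound; [exact: l2norm_ge0|exact: series_push_le]. Qed.

(* The sums T1 + T2 are handled by the isometry l^2 (+) l^2 = l^2 splitting N *)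
(* into even and odd numbers.                                                *)
Definition dominated S : set bop :=
  [set T | exists2 b, S b & exists B, forall x, l2norm (T x) <= l2norm (diag b (B x))].

Lemma dominated_sub S T T' : symmetric_ideals R S ->
  dominated S T -> dominated S T' -> dominated S (T - T').
Proof.
move=> [iS Ssym] [b Sb [B TB]] [b' Sb' [B' TB']].
have id : injective (fun n : nat => n.*2) by exact: double_inj.
have iS2 : injective (fun n : nat => n.*2.+1) by move=> m n [] /double_inj.
pose f := emb_total id; pose g := emb_total iS2.
have fE n : f n = Some n.*2 by [].
have gE n : g n = Some n.*2.+1 by [].
(* The even coordinates of [diag c (D x)] reproduce [diag b (B x)], the odd ones
   [diag b' (B' x)]. *)
pose c := linf_push f b + linf_push g b'; pose D := U f * B + U g * B'.
have even_part x : U (emb_inv f) (diag c (D x)) = diag b (B x).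
  apply: ell2_ext => n.
  have e : emb_inv (emb_inv f) n = Some n.*2 by exact/emb_invP/emb_invP.
  rewrite -[LHS]/(push (emb_inv f) (diag c (D x)) n) /push e.
  have -> : D x = U f (B x) + U g (B' x) by [].
  rewrite -[LHS]/((push f b n.*2 + push g b' n.*2) *
    (push f (B x) n.*2 + push g (B' x) n.*2)).
  rewrite !(push_some _ (fE n)) !(@push_none _ g) ?addr0// => m;
    by rewrite gE => -[] /(congr1 odd); rewrite /= !odd_double.
have odd_part x : U (emb_inv g) (diag c (D x)) = diag b' (B' x).
  apply: ell2_ext => n.
  have e : emb_inv (emb_inv g) n = Some n.*2.+1 by exact/emb_invP/emb_invP.
  rewrite -[LHS]/(push (emb_inv g) (diag c (D x)) n) /push e.
  have -> : D x = U f (B x) + U g (B' x) by [].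
  rewrite -[LHS]/((push f b n.*2.+1 + push g b' n.*2.+1) *
    (push f (B x) n.*2.+1 + push g (B' x) n.*2.+1)).
  rewrite !(push_some _ (gE n)) !(@push_none _ f) ?add0r// => m;
    by rewrite fE => -[] /(congr1 odd); rewrite /= !odd_double.
exists c; first by apply: (ideal_add iS); apply: Ssym; [exists b|exists b'].
(* Each of the two terms costs one copy of the norm of [diag c (D x)], hence the factor 2. *)
exists (2%:R *: D) => x; rewrite bopZE bopZ l2normZ normcMn normc1 mulr2n mulrDl !mul1r.
rewrite bopBE; apply: le_trans (l2normD _ _) _.
rewrite -(scaleN1r (T' x)) l2normZ normcN normc1 mul1r; apply: lerD.
  by apply: le_trans (TB x) _; rewrite -even_part l2norm_emb_op.
by apply: le_trans (TB' x) _; rewrite -odd_part l2norm_emb_op.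
Qed.

Lemma dominated_ideal S : symmetric_ideals R S -> is_ideal setT (dominated S).
Proof.
move=> sS; have [iS _] := sS; split=> //.
- exists 0; first by case: iS.
  by exists 0 => x; rewrite [leLHS]l2norm_0 l2norm_ge0.
- by move=> T T'; exact: dominated_sub.
move=> A T _ [b Sb [B TB]]; split; exists b => //; last first.
  by exists (B * A) => x; exact: TB.
have [M M0 AM] := bop_bound A.
exists (M%:C%C *: B) => x; rewrite bopZE bopZ l2normZ.
have -> : normc M%:C%C = M by rewrite /= expr0n addr0 sqrtr_sqr gtr0_norm.
by apply: le_trans (AM _) _; rewrite ler_pM2l.
Qed.

(** This trades membership in a generated ideal for a single norm inequality. *)
Lemma J_of_dominated S : symmetric_ideals R S -> J_of S `<=` dominated S.
Proof.
move=> sS; apply: smallest_sub; first exact: dominated_ideal.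
by move=> _ [b Sb <-]; exists b => //; exists 1.
Qed.

(** [a] is [b] times the bounded sequence of quotients; where [b n = 0] the bound forces [a n = 0]
    as well. *)
Lemma ideal_dominated S a b (K : R) : is_ideal setT S -> S b ->
  (forall n, normc (a n) <= K * normc (b n)) -> S a.
Proof.
move=> [_ _ _ SM] Sb ab.
have bq : (fun n => a n / b n) \in @bounded_seq R.
  apply/bounded_seqP; exists `|K| => n; rewrite normcM normcV.
  have [->|b0] := eqVneq (normc (b n)) 0; first by rewrite invr0 mulr0.
  have bp : 0 < normc (b n) by rewrite lt_def b0 normc_ge0.
  by rewrite ler_pdivrMr//; apply: le_trans (ab n) _; rewrite ler_wpM2r ?ler_norm// ltW.
have [+ _] := SM (Linf bq) b Logic.I Sb; congr S; apply: linf_ext => n.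
rewrite linfME /=; have [bn|b0] := eqVneq (b n) 0; last by rewrite divfK.
rewrite bn mulr0; apply/esym/eq0_normc/eqP; rewrite eq_le normc_ge0 andbT.
by have := ab n; rewrite bn normc0 mulr0.
Qed.

(* If F were larger, some nonzero x supported on F would have B x vanish on  *)
(* G, and then s |x| <= |diag a x| <= |diag b (B x)| <= M t |x|.             *)
Lemma level_count a b B (M s t : R) (F G : seq nat) :
  0 <= t -> 0 < s -> M * t < s ->
  (forall x, l2norm (B x) <= M * l2norm x) ->
  (forall x, l2norm (diag a x) <= l2norm (diag b (B x))) ->
  uniq F -> (forall m, m \in F -> s <= normc (a m)) ->
  (forall j, t < normc (b j) -> j \in G) -> (size F <= size G)%N.
Proof.
move=> t0 s0 Mts BM ab uF Fa Gb; rewrite leqNgt; apply/negP => GF.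
pose X : 'M[C]_(size F, size G) :=
  \matrix_(i, j) B (basis (nth 0%N F i)) (nth 0%N G j).
(* [X] has more rows than columns, so some nonzero row vector [v] has [v *m X = 0]; its entries are
   the coefficients of [x]. *)
have : kermx X != 0.
  by rewrite kermx_eq0 /row_free neq_ltn (leq_ltn_trans (rank_leq_col X) GF).
case/rowV0Pn => v /sub_kermxP vX v0.
pose x : ell2 := \sum_(i < size F) v ord0 i *: basis (nth 0%N F i).
have xE m : x m = \sum_(i < size F) v ord0 i * (m == nth 0%N F i)%:R.
  by rewrite -dot_basis dot_suml; apply: eq_bigr => i _; rewrite dotZl dot_basis.
have xF (i : 'I_(size F)) : x (nth 0%N F i) = v ord0 i.
  rewrite xE (bigD1 i)//= eqxx mulr1 big1 ?addr0// => j ji.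
  by rewrite nth_uniq// eq_sym val_eqE (negPf ji) mulr0.
have x_out m : m \notin F -> x m = 0.
  move=> mF; rewrite xE big1// => i _; case: eqP => [me|_]; last by rewrite mulr0.
  by move: mF; rewrite me mem_nth.
have BxG j : j \in G -> B x j = 0.
  move=> jG; have lt : (index j G < size G)%N by rewrite index_mem.
  have := congr1 (fun A : 'rV_(size G) => A ord0 (Ordinal lt)) vX.
  rewrite !mxE => <-; rewrite -dot_basis bop_sum dot_suml; apply: eq_bigr => i _.
  by rewrite bopZ dotZl dot_basis mxE /= nth_index.
have x0 : 0 < l2norm x.
  rewrite lt_def l2norm_ge0 andbT; apply: contra v0 => /eqP/l2norm0_eq0 x0.
  by apply/eqP/rowP => i; rewrite -xF x0 mxE.
have : s * l2norm x <= (M * t) * l2norm x.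
  apply: (@le_trans _ _ (l2norm (diag b (B x)))); last first.
    apply: (@le_trans _ _ (t * l2norm (B x))).
      apply: l2norm_le => // j; rewrite -[diag b _ j]/(b j * B x j) normcM.
      have [jG|jG] := boolP (j \in G); first by rewrite BxG// normc0 !mulr0.
      by rewrite ler_wpM2r ?normc_ge0// leNgt; apply: contra jG; exact: Gb.
    by rewrite (mulrC M) -mulrA ler_wpM2l.
  apply: le_trans (ab x); rewrite -ler_pdivlMl//.
  apply: l2norm_le => [|m]; first by rewrite invr_ge0 ltW.
  rewrite -[diag a x m]/(a m * x m) normcM ler_pdivlMl//.
  have [mF|mF] := boolP (m \in F); first by rewrite ler_wpM2r ?normc_ge0// Fa.
  by rewrite x_out// normc0 !mulr0.
by rewrite ler_pM2r// leNgt Mts.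
Qed.

End domination.

(** * Matching increasing families of finite sets *)

Section matching.
Implicit Types (A B : nat -> pred nat) (P : nat -> Prop).

Lemma bounded_of_count (p : pred nat) K :
  (forall F : seq nat, uniq F -> (forall m, m \in F -> p m) -> (size F <= K)%N) ->
  exists N, forall m, p m -> (m < N)%N.
Proof.
elim: K p => [|K IH] p pK.
  exists 0%N => m pm; have := pK [:: m] isT; rewrite ltn0 => H.
  by suff : false by []; apply: H => k; rewrite inE => /eqP->.
have [[m0 pm0]|np] := pselect (exists m, p m); last first.
  by exists 0%N => m pm; case: np; exists m.
have [F uF pF|N pN] := IH (fun m => p m && (m != m0)).
  have m0F : m0 \notin F by apply/negP => /pF; rewrite eqxx andbF.
  have /(_ _ _)/= := pK (m0 :: F); rewrite m0F uF ltnS; apply=> // m.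
  by rewrite inE => /orP[/eqP->//|/pF/andP[]].
exists (maxn N m0.+1) => m pm; rewrite leq_max.
have [->|mm0] := eqVneq m m0; first by rewrite leqnn orbT.
by rewrite pN ?pm.
Qed.

(** As each list extends the previous one, the position of an element does not depend on the level,
    which makes a matching by position consistent. *)
Lemma level_lists A : (forall k m, A k m -> A k.+1 m) ->
  (forall k, exists N, forall m, A k m -> (m < N)%N) ->
  exists s : nat -> seq nat, [/\ forall k, uniq (s k),
    forall k m, (m \in s k) = A k m & forall k, prefix (s k) (s k.+1)].
Proof.
move=> A_nd /choice[N AN].
pose s := fix s k := if k is j.+1
  then s j ++ [seq m <- iota 0 (N k) | A k m & ~~ A j m]
  else [seq m <- iota 0 (N 0%N) | A 0%N m].
have sA k m : (m \in s k) = A k m.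
  elim: k => [|k IH]; rewrite /= ?mem_cat mem_filter mem_iota add0n /=.
    by case Am: (A 0%N m) => //=; exact: AN.
  rewrite IH; have := @A_nd k m; case: (A k m) => /= [->//|_].
  by rewrite andbT; case Am: (A k.+1 m) => //=; exact: AN.
exists s; split=> // [|k]; last by rewrite /= prefix_prefix.
elim=> [|k IH] /=; first by rewrite filter_uniq ?iota_uniq.
rewrite cat_uniq IH filter_uniq ?iota_uniq// andbT; apply/hasPn => m.
by rewrite mem_filter => /andP[/andP[_ nA] _]; rewrite sA.
Qed.

Lemma prefix_nth_le (s : nat -> seq nat) : (forall k, prefix (s k) (s k.+1)) ->
  forall k l i, (k <= l)%N -> (i < size (s k))%N ->
  (i < size (s l))%N /\ nth 0%N (s l) i = nth 0%N (s k) i.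
Proof.
move=> sp k l i kl ik; elim: l kl => [|l IH]; first by rewrite leqn0 => /eqP<-.
rewrite leq_eqVlt => /orP[/eqP<-//|]; rewrite ltnS => /IH[il <-].
have /prefixP[t ->] := sp l; rewrite size_cat nth_cat il; split=> //.
exact: ltn_addr.
Qed.

(** The entry of [s k] at position [i] is paired with the entry of [t k] at position [i], which
    exists by the comparison of sizes. *)
Lemma matching (s t : nat -> seq nat) :
  (forall k, prefix (s k) (s k.+1)) -> (forall k, prefix (t k) (t k.+1)) ->
  (forall k, uniq (s k)) -> (forall k, uniq (t k)) ->
  (forall k, (size (s k) <= size (t k))%N) ->
  exists f : Emb, forall k m, m \in s k -> exists2 j, j \in t k & f j = Some m.
Proof.
move=> sp tp us ut st.
pose r j m := exists k i, [/\ (i < size (s k))%N, j = nth 0%N (t k) i & m = nth 0%N (s k) i].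
have common j m j' m' : r j m -> r j' m' -> exists l i i',
    [/\ (i < size (s l))%N, (i' < size (s l))%N,
        j = nth 0%N (t l) i /\ m = nth 0%N (s l) i &
        j' = nth 0%N (t l) i' /\ m' = nth 0%N (s l) i'].
  move=> [k1 [i [ik -> ->]]] [k2 [i' [ik' -> ->]]].
  exists (maxn k1 k2), i, i'.
  have [is1 es1] := prefix_nth_le sp (leq_maxl k1 k2) ik.
  have [is2 es2] := prefix_nth_le sp (leq_maxr k1 k2) ik'.
  have [_ et1] := prefix_nth_le tp (leq_maxl k1 k2) (leq_trans ik (st k1)).
  have [_ et2] := prefix_nth_le tp (leq_maxr k1 k2) (leq_trans ik' (st k2)).
  by rewrite es1 es2 et1 et2.
have [j m m' rm rm'|j j' m rj rj'|f fE] := @emb_of_rel r.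
- have [l [i [i' [il il' [ej ->] [ej' ->]]]]] := common _ _ _ _ rm rm'.
  have /eqP := etrans (esym ej) ej'.
  by rewrite nth_uniq ?(leq_trans _ (st l))// => /eqP->.
- have [l [i [i' [il il' [-> em] [-> em']]]]] := common _ _ _ _ rj rj'.
  have /eqP := etrans (esym em) em'.
  by rewrite nth_uniq// => /eqP->.
exists f => k m mk; have ik : (index m (s k) < size (s k))%N by rewrite index_mem.
exists (nth 0%N (t k) (index m (s k))).
  by rewrite mem_nth// (leq_trans ik).
by apply/fE; exists k, (index m (s k)); rewrite nth_index.
Qed.

Lemma unbounded_enum (P : nat -> Prop) : (forall N, exists2 j, (N <= j)%N & P j) ->
  exists h : nat -> nat, injective h /\ forall n, P (h n).
Proof.
move=> Pinf; have /choice[c cP] N : exists j, (N <= j)%N /\ P j.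
  by have [j] := Pinf N; exists j.
pose h := fix h n := if n is m.+1 then c (h m).+1 else c 0%N.
exists h; split; last by case=> [|n]; [case: (cP 0%N)|case: (cP (h n).+1)].
have hlt m n : (m < n)%N -> (h m < h n)%N.
  elim: n => // n IH; rewrite ltnS leq_eqVlt => /orP[/eqP->|/IH lt].
    by case: (cP (h n).+1).
  by apply: ltn_trans lt _; case: (cP (h n).+1).
by move=> m n e; case: (ltngtP m n) => // /hlt; rewrite e ltnn.
Qed.

End matching.

(** * Diagonal operators dominated by a symmetric ideal *)

Section membership.
Variable R : realType.
Local Notation C := R[i].
Local Notation linf := (linf R).
Implicit Types (a b : linf) (S : set linf).

(** Pulling [b] back along an enumeration of indices where it exceeds [t] gives a member of [S]
    bounded below, and this dominates every bounded sequence. *)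
Lemma symmetric_ideal_full S b (t : R) : symmetric_ideals R S -> S b -> 0 < t ->
  (forall N, exists2 j, (N <= j)%N & t < normc (b j)) -> forall a, S a.
Proof.
move=> [iS Ssym] Sb t0 /unbounded_enum[h [ih bh]] a.
have [L aL] := bounded_seqP (linf_val a) (linf_valP a).
pose f := emb_inv (emb_total ih).
apply: (@ideal_dominated _ S a (linf_push f b) (`|L| / t)) => //.
  by apply: Ssym; exists b.
move=> n; rewrite /= (@push_some _ f _ (h n)); last exact/emb_invP.
rewrite -mulrA; apply: le_trans (aL n) _; apply: le_trans (ler_norm L) _.
by rewrite ler_peMr// mulrC ler_pdivlMr// mul1r ltW.
Qed.

(** Counting level sets takes the place of comparing singular values: one partial injection matches
    the level sets of [a] with those of [b] at all thresholds at once. *)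
Lemma dominated_diag S a : symmetric_ideals R S -> dominated S (diag_op a) -> S a.
Proof.
move=> sS [b Sb [B aB]]; have [iS Ssym] := sS.
have [M M0 BM] := bop_bound B.
have [L aL] := bounded_seqP (linf_val a) (linf_valP a).
have [[t t0 bt]|fin] := pselect (exists2 t : R, 0 < t &
    forall N, exists2 j, (N <= j)%N & t < normc (b j)).
  exact: symmetric_ideal_full sS Sb t0 bt a.
pose tau k : R := k.+1%:R^-1.
have tau0 k : 0 < tau k by rewrite invr_gt0.
have tauS k : tau k.+1 <= tau k by rewrite lef_pV2 ?posrE// ler_nat.
(* The factor 2 provides the strict inequality [M * tau k < 2 * M * tau k] that [level_count]
   requires. *)
pose Al k m := 2 * M * tau k <= normc (a m).
pose Bl k j := tau k < normc (b j).
have Bfin k : exists N, forall j, Bl k j -> (j < N)%N.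
  apply: contrapT => nN; apply: fin; exists (tau k) => // N.
  apply: contrapT => nj; apply: nN; exists N => j bj.
  by rewrite ltnNge; apply/negP => Nj; apply: nj; exists j.
have [t [ut tE tp]] := @level_lists Bl (fun k m => le_lt_trans (tauS k)) Bfin.
have count k F : uniq F -> (forall m, m \in F -> Al k m) -> (size F <= size (t k))%N.
  move=> uF FA; apply: (@level_count R a b B M (2 * M * tau k) (tau k)) => //.
  - exact: ltW.
  - by rewrite !mulr_gt0.
  - by rewrite -mulrA ltr_pMl ?mulr_gt0// ltr1n.
  - by move=> j bj; rewrite tE.
have Afin k : exists N, forall m, Al k m -> (m < N)%N.
  exact: bounded_of_count (count k).
have Amon k m : Al k m -> Al k.+1 m.
  by apply: le_trans; rewrite ler_wpM2l// mulr_ge0// ltW.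
have [s [us sE sp]] := @level_lists Al Amon Afin.
have [|f fP] := matching sp tp us ut.
  by move=> k; apply: count => // m; rewrite sE.
apply: (@ideal_dominated _ S a (linf_push f b) (4 * M + `|L|)) => //.
  by apply: Ssym; exists b.
move=> m; have K0 : 0 <= 4 * M + `|L| by rewrite addr_ge0// mulr_ge0// ltW.
have [->|am0] := eqVneq (normc (a m)) 0; first by rewrite mulr_ge0 ?normc_ge0.
have {}am0 : 0 < normc (a m) by rewrite lt_def am0 normc_ge0.
have exk : exists k, Al k m.
  exists (Num.truncn (2 * M / normc (a m))).
  by rewrite /Al /tau ler_pdivrMr// -ler_pdivrMl// [leLHS]mulrC ltW// truncnS_gt.
have [k Akm kmin] := ex_minnP exk.
have [j + fj] : exists2 j, j \in t k & f j = Some m by apply: fP; rewrite sE.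
rewrite tE /= (push_some _ fj) => bj.
apply: le_trans (ler_wpM2l K0 (ltW bj)).
(* For least level 0, [tau 0 = 1] and the bound [L] on [a] suffices. Otherwise minimality gives
   [normc (a m) < 2 * M * tau k], and [tau k <= 2 * tau k.+1] turns this into the constant
   [4 * M]. *)
rewrite mulrDl; case: k Akm kmin {bj} => [|k] Akm kmin.
  rewrite /tau invr1 !mulr1; apply: le_trans (aL m) _; apply: le_trans (ler_norm L) _.
  by rewrite lerDr mulr_ge0// ltW.
have : normc (a m) < 2 * M * tau k.
  by rewrite ltNge; apply/negP => /kmin; rewrite ltnn.
move=> /ltW am; apply: le_trans am _; apply: (@le_trans _ _ (4 * M * tau k.+1)).
  have -> : 4 * M * tau k.+1 = 2 * M * (2 * tau k.+1) by ring.
  rewrite ler_wpM2l ?mulr_ge0 ?(ltW M0)// /tau ler_pdivlMr// mulrC ler_pdivrMr//.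
  by rewrite -natrM ler_nat mul2n -addnn addSn addnS !ltnS leq_addr.
by rewrite lerDl mulr_ge0// ltW.
Qed.

Lemma S_of_J_of S : symmetric_ideals R S -> S_of (J_of S `&` Gamma R) = S.
Proof.
move=> sS; apply/seteqP; split=> [a [Ja _]|a Sa].
  exact: dominated_diag sS (J_of_dominated sS Ja).
split; last exact: Gamma_diag.
by apply: sub_gen_smallest; exists a.
Qed.

End membership.

(** * Ideals of bounded operators: parts (ii) and (iii) *)

Section ideals_of_bop.
Variable R : realType.
Local Notation bop := (bop R).
Implicit Types (I J X : set bop) (S : set (linf R)).

Lemma ideal_gen_ideal X : is_ideal setT (ideal_gen X).
Proof.
split=> //.
- by move=> J [[]].
- by move=> x y Ix Iy J iJX; have [[_ _ JB _] _] := iJX; apply: JB; [exact: Ix|exact: Iy].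
- move=> a x _ Ix; split=> J iJX; have [[_ _ _ JM] _] := iJX.
    by case: (JM a x Logic.I (Ix J iJX)).
  by case: (JM a x Logic.I (Ix J iJX)).
Qed.

(** The intersection is an ideal of [Gamma], so part (i) recovers it from its diagonals, which
    [S_of_J_of] computes. *)
Lemma J_of_Gamma S : symmetric_ideals R S -> J_of S `&` Gamma R = I_of S.
Proof.
move=> sS; have iJ : is_ideal setT (J_of S) by exact: ideal_gen_ideal.
by rewrite -(I_of_S_of (ideal_setI_Gamma iJ)) S_of_J_of.
Qed.

(** For [T] in [J], the diagonal factors from [diagonalization] lie in both [J] and [Gamma], and [T]
    is rebuilt from them. *)
Lemma ideal_gen_Gamma J : is_ideal setT J -> ideal_gen (J `&` Gamma R) = J.
Proof.
move=> iJ; apply/seteqP; split=> [|T JT].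
  by apply: smallest_sub => // T [].
have [_ _ _ JM] := iJ.
have [a [Q [W [TE aE]]]] := diagonalization T.
have iG := ideal_gen_ideal (J `&` Gamma R); have [_ _ _ GM] := iG.
pose D p := Q p * diag_op (a p) * adj (W p).
rewrite TE; apply: (@ideal_sum _ _ _ _ _ D iG) => p.
have Gp : ideal_gen (J `&` Gamma R) (diag_op (a p)).
  apply: sub_gen_smallest; split; last exact: Gamma_diag.
  rewrite aE; have [H _] := JM (adj (Q p)) T Logic.I JT.
  by case: (JM (W p) _ Logic.I H).
have [H _] := GM (Q p) _ Logic.I Gp.
by case: (GM (adj (W p)) _ Logic.I H).
Qed.

(** [J_of (S_of I)] is an ideal of B that contains [I] and meets [Gamma] exactly in [I], so the
    smaller ideal generated by [I] does too. *)
Lemma ideal_gen_setI_Gamma I : is_ideal (Gamma R) I -> ideal_gen I `&` Gamma R = I.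
Proof.
move=> iI; have sS := S_of_symmetric iI.
apply/seteqP; split=> [T [IT GT]|T IT]; last first.
  by split; [exact: sub_gen_smallest|case: iI => + _ _ _; exact].
rewrite -(I_of_S_of iI) -J_of_Gamma//; split=> //.
apply: smallest_sub IT; first exact: ideal_gen_ideal.
by move=> T'; rewrite -{1}(I_of_S_of iI) -J_of_Gamma// => -[].
Qed.

End ideals_of_bop.

Lemma bij_with_inverseP (X Y : Type) (A : set X) (B : set Y) (f : X -> Y) (g : Y -> X) :
  set_fun A B f -> set_fun B A g -> (forall x, A x -> g (f x) = x) ->
  (forall y, B y -> f (g y) = y) -> bij_with_inverse A B f g.
Proof.
move=> AB BA gf fg; split=> //; split=> //.
  by move=> x y /set_mem Ax /set_mem Ay e; rewrite -(gf x)// e gf.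
by move=> y By; exists (g y); [exact: BA|exact: fg].
Qed.

Theorem theorem4p5 (R : realType) :
  [/\ bij_with_inverse (symmetric_ideals R) (ideals (Gamma R))
        (@I_of R) (@S_of R),
      bij_with_inverse (ideals [set: bop R]) (ideals (Gamma R))
        (fun J => J `&` Gamma R) (fun I => ideal_gen I) &
      forall S : set (linf R), symmetric_ideals R S ->
        J_of S `&` Gamma R = I_of S].
Proof.
split; last exact: J_of_Gamma.
  apply: bij_with_inverseP.
  - exact: I_of_ideal.
  - exact: S_of_symmetric.
  - exact: S_of_I_of.
  - exact: I_of_S_of.
apply: bij_with_inverseP.
- exact: ideal_setI_Gamma.
- by move=> I _; exact: ideal_gen_ideal.
- exact: ideal_gen_Gamma.
- exact: ideal_gen_setI_Gamma.
Qed.
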